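(* Let $A$ be a $d\times n$ integer matrix ($n>d$) whose $d\times d$ minors are relatively prime, let $\theta\in\mathbb{N}\mathcal{A}$ be a smooth degree, and let $\mathcal{H}=\mathcal{H}(\mathcal{B},\psi)$ be the associated affine hyperplane arrangement in $\mathbb{R}^{n-d}$. Let $F_1,\dots,F_r$ be the $(n-d)$-dimensional cells of the bounded complex $\mathcal{H}^{bd}$, let $\Gamma=\mathcal{H}^{bd}\setminus\bigcup_j F_j$, and let $\mathcal{N}$ be the nerve of the cover of $\Gamma$ by its intersections with the hyperplanes of $\mathcal{H}$. Then the linear map $$\Psi_\star: H_\star(\Gamma;\mathbb{Z})\to H_\star(\mathcal{N};\mathbb{Z}),\qquad [F_j]\mapsto\Psi[F_j]=\sum_{v\in\partial F_j}\Psi(v),$$ is an isomorphism.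
   Context: Let $A=[a_1,\dots,a_n]$ be a $d\times n$ integer matrix whose $d\times d$ minors are relatively prime, with columns $\mathcal{A}=\{a_1,\dots,a_n\}\subset\mathbb{Z}^d$; $\mathbb{N}\mathcal{A}$ denotes the semigroup of non-negative integer combinations of the $a_i$. A degree $\theta\in\mathbb{N}\mathcal{A}$ is generic if it lies in no linear subspace of $\mathbb{R}^d$ spanned by fewer than $d$ of the $a_i$; it is a smooth degree if it is generic and every $d\times d$ submatrix of $A$ whose columns form a basis of $\mathbb{R}^d$ has determinant $\pm1$. Choose an $n\times(n-d)$ integer matrix $B$ with rows $b_1,\dots,b_n$ such that $0\to\mathbb{Z}^{n-d}\xrightarrow{B}\mathbb{Z}^n\xrightarrow{A}\mathbb{Z}^d\to0$ is exact, put $\mathcal{B}=\{b_1,\dots,b_n\}$, and choose $\psi\in\mathbb{Z}^n$ with $A\psi=\theta$. The arrangement $\mathcal{H}(\mathcal{B},\psi)$ consists of the affine hyperplanes $\{x\in\mathbb{R}^{n-d}:b_i\cdot x+\psi_i=0\}$ (those with $b_i=0$ are empty and are discarded); denote them $H_1,\dots,H_s$. Since $\theta$ is generic, a set of these hyperplanes has non-empty intersection if and only if the corresponding $b_i$ are linearly independent. The arrangement subdivides $\mathbb{R}^{n-d}$ into relatively open polyhedral cells; $\mathcal{H}^{bd}$ is the polyhedral complex of all bounded cells. $F_1,\dots,F_r$ are its (open) cells of dimension $n-d$, and $\Gamma=\mathcal{H}^{bd}\setminus\bigcup_jF_j$, a CW-complex homotopy equivalent to a wedge of $r$ spheres of dimension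 $n-d-1$. Put $\Gamma_i=\Gamma\cap H_i$. $\mathcal{N}$ is the nerve of the cover $\{\Gamma_1,\dots,\Gamma_s\}$ of $\Gamma$: the simplicial complex with vertices $v_1,\dots,v_s$ in which $\{v_{i_1},\dots,v_{i_k}\}$ is a simplex if and only if $\Gamma_{i_1}\cap\dots\cap\Gamma_{i_k}\ne\emptyset$, equivalently if and only if the vectors of $\mathcal{B}$ corresponding to $H_{i_1},\dots,H_{i_k}$ are linearly independent. Thus $\mathcal{N}$ is the independence complex of the matroid $M(\mathcal{B})$. Orientations: let $\sigma$ be a $k$-dimensional cell of $\Gamma$, let $(H_{\sigma_1},\dots,H_{\sigma_{n-d-k}})$ be the ordered set of hyperplanes containing $\sigma$, and choose a normal $\eta_{\sigma_i}$ to each. These define an orientation of $\sigma$: an ordered basis $(w_1,\dots,w_k)$ of the tangent space of $\sigma$ is positively oriented iff $(\eta_{\sigma_1},\dots,\eta_{\sigma_{n-d-k}},w_1,\dots,w_k)$ is a positively oriented basis of $\mathbb{R}^{n-d}$. Let $F=F_j$ and for each hyperplane incident to $F$ choose the normal pointing inward to $F$. $[F]$ is the class in $H_{n-d-1}(\Gamma;\mathbb{Z})$ (CW-homology) of the cycle $\sum[\sigma]$, summed over all $(n-d-1)$-dimensional cells $\sigma$ in the boundary of $F$, each oriented by its inward normal. For a vertex $v$ of $\partial F$, exactly $n-d$ hyperplanes $H_{i_1},\dots,H_{i_{n-d}}$ contain $v$, and $\Psi(v)$ is the oriented simplex $[v_{i_1},\dots,v_{i_{n-d}}]$ with orientation determined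 by that of $v$, i.e. $\Psi(v)=\mathrm{sign}\det(\eta_{i_1},\dots,\eta_{i_{n-d}})\,[v_{i_1},\dots,v_{i_{n-d}}]$ with $\eta_{i}$ the inward normals of $F$. The chain $\Psi[F]=\sum_{v\in\partial F}\Psi(v)$, summed over the vertices of $F$, is a cycle in $C_{n-d-1}(\mathcal{N};\mathbb{Z})$. The classes $[F_1],\dots,[F_r]$ form a basis of $H_\star(\Gamma;\mathbb{Z})$, and $\Psi_\star$ is the linear extension of $[F_j]\mapsto\Psi[F_j]$. Here $H_\star$ denotes reduced homology, which for $\Gamma$ and $\mathcal{N}$ is concentrated in degree $n-d-1$. *)

(* Defs.v *)
From HB Require Import structures.
From mathcomp Require Import all_boot all_order all_algebra.
From mathcomp Require Import all_classical all_reals all_analysis.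

Set Implicit Arguments.
Unset Strict Implicit.
Unset Printing Implicit Defensive.

Import Order.TTheory GRing.Theory Num.Theory.
Import numFieldNormedType.Exports.

Local Open Scope ring_scope.
Local Open Scope quotient_scope.

(* [gen] is a finite set of (candidate) oriented cells, [gen_dim k] selects the
   ones that are k-dimensional cells of the complex, [inc x y] is the incidence
   number [x : y], and [aug] is the augmentation C_0 -> Z on generators. *)
Record based_complex := BasedComplex {
  gen : finType;
  gen_dim : nat -> pred gen;
  inc : gen -> gen -> int;
  aug : gen -> int
}.

Definition chain (X : based_complex) := {ffun gen X -> int}.
HB.instance Definition _ X := GRing.Zmodule.on (chain X).

Section Homology.
Variable X : based_complex.
Implicit Types (c e : chain X) (k : nat).

Definition kchains k : {pred chain X} :=
  [pred c : chain X | [forall x, (c x != 0) ==> gen_dim k x]].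

Definition bdry c : chain X := [ffun y => \sum_x c x * inc x y].

(* In degree 0 the boundary is the augmentation: homology is reduced. *)
Definition cycles k : {pred chain X} :=
  [pred c : chain X | [&& c \in kchains k, bdry c == 0 &
                          (k == 0%N) ==> (\sum_x c x * aug x == 0)]].

Lemma bdryB c e : bdry (c - e) = bdry c - bdry e.
Proof.
apply/ffunP => y; rewrite !ffunE -sumrB; apply: eq_bigr => x _.
by rewrite !ffunE mulrBl.
Qed.

Lemma kchains_zmod_closed k : zmod_closed (kchains k).
Proof.
split=> [|c e /forallP hc /forallP he].
  by apply/forallP => x; rewrite ffunE eqxx.
apply/forallP => x; apply/implyP; rewrite !ffunE => nz.
have [c0|/(implyP (hc x))//] := eqVneq (c x) 0.
by apply: (implyP (he x)); apply: contraNneq nz => ->; rewrite c0 subr0.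
Qed.
HB.instance Definition _ k :=
  GRing.isZmodClosed.Build (chain X) (kchains k) (kchains_zmod_closed k).

Lemma cycles_zmod_closed k : zmod_closed (cycles k).
Proof.
split=> [|c e].
  have b0 : bdry 0 = 0 by rewrite -[in LHS](subrr (0 : chain X)) bdryB subrr.
  rewrite inE rpred0 b0 eqxx /=; apply/implyP => _.
  by rewrite big1 // => x _; rewrite ffunE mul0r.
move=> /and3P[c1 /eqP c2 c3] /and3P[e1 /eqP e2 e3].
rewrite inE rpredB // bdryB c2 e2 subrr eqxx /=; apply/implyP => k0.
move: (implyP c3 k0) (implyP e3 k0) => /eqP h1 /eqP h2.
have -> : \sum_x (c - e) x * aug x = \sum_x c x * aug x - \sum_x e x * aug x.
  by rewrite -sumrB; apply: eq_bigr => x _; rewrite !ffunE mulrBl.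
by rewrite h1 h2 subrr.
Qed.
HB.instance Definition _ k :=
  GRing.isZmodClosed.Build (chain X) (cycles k) (cycles_zmod_closed k).

Definition cycle_group k := {c : chain X | c \in cycles k}.
HB.instance Definition _ k := SubChoice.on (cycle_group k).
HB.instance Definition _ k :=
  [SubChoice_isSubZmodule of cycle_group k by <:].

Definition boundaries k : {pred cycle_group k} :=
  [pred z : cycle_group k |
    `[< exists2 e : chain X, e \in kchains k.+1 & val z = bdry e >]].
Arguments boundaries : clear implicits.

Lemma boundaries_zmod_closed k : zmod_closed (boundaries k).
Proof.
split=> [|z t /asboolP[e he ez] /asboolP[f hf ft]].
  apply/asboolP; exists 0; first exact: rpred0.
  by rewrite -[in RHS](subrr (0 : chain X)) bdryB subrr raddf0.
apply/asboolP; exists (e - f); first exact: rpredB.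
by rewrite bdryB -ez -ft raddfB.
Qed.
HB.instance Definition _ k :=
  GRing.isZmodClosed.Build (cycle_group k) (boundaries k)
    (boundaries_zmod_closed k).

Definition homology k := Quotient.quot (boundaries k).
HB.instance Definition _ k := GRing.Zmodule.on (homology k).

(* Meaningful only for [c \in cycles k]; other chains have class 0. *)
Definition hclass k c : homology k :=
  \pi_(Quotient.quot (boundaries k)) (insubd (0 : cycle_group k) c).

End Homology.
Arguments cycles : clear implicits.
Arguments boundaries : clear implicits.
Arguments hclass {X} k c.

(* The sign vector of a cell: [None] on the hyperplane, [Some true] (resp.
   [Some false]) on its positive (resp. negative) side. *)
Definition covector (n : nat) := {ffun 'I_n -> option bool}.

Definition sign_val (s : option bool) : int :=
  if s is Some b then (if b then 1 else -1) else 0.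

Section Arrangement.
Variables (R : realType) (n m : nat) (B : 'M[int]_(n, m)) (psi : 'cV[int]_n).
Implicit Types (x y : 'rV[R]_m) (i : 'I_n) (s t v F : covector n).

Definition normal i : 'rV[R]_m := row i (map_mx intr B).

Definition affine_form i x : R :=
  \sum_j (B i j)%:~R * x 0 j + (psi i 0)%:~R.

(* Indices with [row i B = 0] are kept: for a generic degree [psi i 0 <> 0] for
   those, so [hyperplane i] is empty, contains no cell and meets no [cover j]. *)
Definition hyperplane i : set 'rV[R]_m := [set x | affine_form i x = 0]%classic.

(* Possibly empty; the cells of the arrangement are the nonempty ones. *)
Definition cell s : set 'rV[R]_m :=
  [set x | forall i, sgz (affine_form i x) = sign_val (s i)]%classic.

Definition zeros s : {set 'I_n} := [set i | s i == None]%SET.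

(* Row space = direction space of the affine hull of a nonempty [cell s]. *)
Definition tangent s : 'M[R]_m :=
  kermx (\matrix_(i < n) (if i \in zeros s then normal i else 0))^T.

Definition cell_dim s : nat := \rank (tangent s).

Definition bounded_cell s : Prop :=
  (cell s !=set0)%classic /\ bounded_set (cell s).

Definition region F : Prop := bounded_cell F /\ cell_dim F = m.

Definition Gamma : set 'rV[R]_m :=
  ((\bigcup_(s in bounded_cell) cell s) `\` (\bigcup_(F in region) cell F))%classic.

Definition face t s : Prop :=
  (cell t !=set0)%classic /\ (cell t `<=` closure (cell s))%classic.

Definition tangent_basis s : seq 'rV[R]_m :=
  [seq row l (row_base (tangent s)) | l <- enum 'I_(\rank (tangent s))].

(* Sign of the ordered basis [w] of [tangent s] for the orientation of [cell s]
   given by the normals [eps i * normal i] to the hyperplanes containing it. *)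
Definition orient (eps : 'I_n -> option bool) s (w : seq 'rV[R]_m) : int :=
  sgz (\det (\matrix_(l < m)
    nth 0 ([seq (sign_val (eps j))%:~R *: normal j | j <- enum (zeros s)] ++ w) l)).

(* Reference normals, fixing the generators of the cellular chain groups. *)
Definition ref_normals : 'I_n -> option bool := fun=> Some true.

(* Coefficient of [cell s], oriented by [eps], on the reference generator. *)
Definition orient_coef (eps : 'I_n -> option bool) s : int :=
  orient eps s (tangent_basis s) * orient ref_normals s (tangent_basis s).

(* Cellular incidence number, with the "outward vector first" convention: a
   difference of a point of [t] and a point of [s] is tangent to [s] and points
   out of [s] through its facet [t]. *)
Definition cell_inc s t : int :=
  if `[< face t s >] && (cell_dim s == (cell_dim t).+1) then
    orient ref_normals s ((xget 0 (cell t) - xget 0 (cell s)) :: tangent_basis t)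
    * orient ref_normals t (tangent_basis t)
  else 0.

(* An oriented 0-cell is plus or minus the underlying point, whence [aug]. *)
Definition Gamma_complex : based_complex :=
  @BasedComplex (covector n)
    (fun k s => `[< [/\ bounded_cell s, ~ region s & cell_dim s = k] >])
    cell_inc
    (fun v => orient ref_normals v [::]).

Definition cover i : set 'rV[R]_m := (Gamma `&` hyperplane i)%classic.

Definition nerve_simplex (S : {set 'I_n}) : Prop :=
  (\bigcap_(i in [set` S]) cover i !=set0)%classic.

(* The generator [S] is the simplex oriented by increasing vertex order; the
   empty simplex is left to the augmentation. *)
Definition simplex_inc (S T : {set 'I_n}) : int :=
  if T == finset.set0 then 0 else
  \sum_(i in S | T == (S :\ i)%SET) (-1) ^+ #|[set j in S | (j < i)%N]%SET|.

Definition nerve_complex : based_complex :=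
  @BasedComplex {set 'I_n}
    (fun k S => `[< nerve_simplex S >] && (#|S| == k.+1))
    simplex_inc
    (fun=> 1).

(* [F i * normal i] is the normal to the i-th hyperplane pointing to the side of
   [F], so orienting by the covector [F] is orienting by inward normals. *)
Definition region_chain F : chain Gamma_complex :=
  [ffun s => if `[< face s F >] && (cell_dim F == (cell_dim s).+1)
             then orient_coef F s else 0].

Definition Psi_chain F : chain nerve_complex :=
  [ffun S => \sum_(v | `[< face v F >] && (cell_dim v == 0%N))
               orient F v [::] * (S == zeros v)%:R].

End Arrangement.

Section Degrees.
Variables (R : realType) (d n : nat) (A : 'M[int]_(d, n)).

Definition minors_coprime : Prop :=
  \big[gcdn/0%N]_(f : {ffun 'I_d -> 'I_n}) `|\det (colsub f A)|%N = 1%N.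

Definition in_semigroup (theta : 'cV[int]_d) : Prop :=
  exists u : 'I_n -> nat, theta = \sum_i col i A *+ u i.

Definition generic_degree (theta : 'cV[int]_d) : Prop :=
  in_semigroup theta /\
  forall S : {set 'I_n}, (#|S| < d)%N ->
    ~ exists c : 'I_n -> R,
        map_mx intr theta = \sum_(i in S) c i *: map_mx intr (col i A).

Definition smooth_degree (theta : 'cV[int]_d) : Prop :=
  generic_degree theta /\
  forall f : 'I_d -> 'I_n,
    (map_mx intr (colsub f A) : 'M[R]_d) \in unitmx ->
    \det (colsub f A) = 1 \/ \det (colsub f A) = -1.

Definition short_exact (m : nat) (B : 'M[int]_(n, m)) : Prop :=
  [/\ forall z : 'cV[int]_m, B *m z = 0 -> z = 0,
      forall y : 'cV[int]_n, A *m y = 0 <-> exists z : 'cV[int]_m, y = B *m z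
    & forall t : 'cV[int]_d, exists y : 'cV[int]_n, A *m y = t].

End Degrees.

(* Main.v *)
Require Import Defs.
From HB Require Import structures.
From mathcomp Require Import all_classical all_reals all_analysis.
From mathcomp Require Import all_boot all_order all_algebra.
From mathcomp Require Import ring lra.

Set Implicit Arguments.
Unset Strict Implicit.
Unset Printing Implicit Defensive.

Import Order.TTheory GRing.Theory Num.Theory.
Import numFieldNormedType.Exports.

Local Open Scope ring_scope.

(** Write [m.+1] for n - d and [b i] for the rows of B. Genericity of the degree
    makes the arrangement simple ([generic_simple]): hyperplanes with a common
    point have independent normals. The cells are then sign vectors ordered by
    [preceq], the vertices are the bases [S] of the matroid of the rows, and the
    cells around the vertex of [S] are all the sign vectors above it
    ([realizable_up]).

    In degree m neither complex has boundaries, so the two homology groups are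
    groups of cycles. Up to the sign of the determinant of [S], a chain of the
    nerve is a function h of the vertices, and it is a cycle when on each line of
    the arrangement the values of h, signed by the slopes of the hyperplanes that
    cut the line, add up to zero ([nerve_cyclesP]). If f is an integer function on
    the bounded regions, the sum of the f(F) Psi[F] is the mixed difference of f
    around each vertex.

    The isomorphism is a map [Phi] defined on all the cycles c of Gamma. Such a
    c is thought of as the jumps of an unknown f across the walls. At the vertex
    of [S] one takes the mixed difference, along all the hyperplanes of [S] but
    one, of the restriction of c to the last one ([flux]); that the boundary of c
    vanishes on the cells of codimension two means that the choice of this last
    one is immaterial ([flux_indep]). Then [Phi] maps [F] to Psi[F]
    ([Phi_region]); it maps cycles to cycles because an edge of a bounded cell is
    a segment with two ends ([edge_sum], [Phi_cycle]); and it is injective, since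
    at the lowest vertex of the support of c a single cell contributes to the
    flux ([Phi_inj]).

    It remains to see that the Psi[F] span the cycles of the nerve
    ([nerve_cycles_span]). Given h and a generic linear form l, let f(F) be the
    sum of the values h(S), up to sign, over those [S] for which F lies in the
    simplicial cone, bounded by the hyperplanes of [S], on which l is minimal at
    the apex ([sweep]); this is the decomposition of a polytope into cones of
    Lawrence and Varchenko, read backwards. The mixed differences of f are h
    ([mixed_difference]). If h is a cycle then f does not depend on l
    ([sweep_indep]): when l crosses the span of m rows, the cones at the vertices
    of the corresponding line change, and their total change is a multiple of the
    sum of h along that line ([sweep_cross]). For an unbounded F some l has no
    cone containing F, so that f(F) = 0 ([sweep_unbounded]), and h is the
    combination of the Psi[F] with coefficients f(F).

    Consequently the classes of the regions generate the homology of Gamma, which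
    makes the homomorphism unique. *)

(** * Linear algebra of the rows of [B] *)

Lemma sgz_sqr (R : realDomainType) (x : R) : x != 0 -> sgz x * sgz x = 1.
Proof. by move=> x0; rewrite -sgzM gtr0_sgz // -expr2 lt_neqAle eq_sym sqrf_eq0 x0 sqr_ge0. Qed.

Section DotProduct.
Variables (R : realType) (p : nat).
Implicit Types (x y z : 'rV[R]_p) (a : R).

Definition dot x y : R := \sum_j x 0 j * y 0 j.

Lemma dotE x y : dot x y = (x *m y^T) 0 0.
Proof. by rewrite mxE; apply: eq_bigr => j _; rewrite mxE. Qed.

Lemma dotC x y : dot x y = dot y x.
Proof. by apply: eq_bigr => j _; rewrite mulrC. Qed.

Lemma dotDr x y z : dot x (y + z) = dot x y + dot x z.
Proof. by rewrite -big_split; apply: eq_bigr => j _; rewrite mxE mulrDr. Qed.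

Lemma dotZr x a y : dot x (a *: y) = a * dot x y.
Proof. by rewrite mulr_sumr; apply: eq_bigr => j _; rewrite mxE mulrCA. Qed.

Lemma dotNr x y : dot x (- y) = - dot x y.
Proof. by rewrite -scaleN1r dotZr mulN1r. Qed.

Lemma dotBr x y z : dot x (y - z) = dot x y - dot x z.
Proof. by rewrite dotDr dotNr. Qed.

Lemma dot0r x : dot x 0 = 0.
Proof. by rewrite -(scale0r 0) dotZr mul0r. Qed.

Lemma dotDl x y z : dot (y + z) x = dot y x + dot z x.
Proof. by rewrite dotC dotDr !(dotC x). Qed.

Lemma dotZl x a y : dot (a *: y) x = a * dot y x.
Proof. by rewrite dotC dotZr (dotC x). Qed.

Lemma dotNl x y : dot (- y) x = - dot y x.
Proof. by rewrite dotC dotNr (dotC x). Qed.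

Lemma dot_suml (I : finType) (P : pred I) (F : I -> 'rV[R]_p) x :
  dot (\sum_(i | P i) F i) x = \sum_(i | P i) dot (F i) x.
Proof.
by apply: (big_morph (fun z => dot z x)) => [y z|]; rewrite ?dotDl // dotC dot0r.
Qed.

Lemma dot_eq0 x : (dot x x == 0) = (x == 0).
Proof.
apply/idP/eqP => [|->]; last by rewrite dot0r.
rewrite psumr_eq0 => [|j _]; last by rewrite -expr2 sqr_ge0.
move=> /allP x0; apply/rowP => j; rewrite mxE; apply/eqP.
by move: (x0 j (mem_index_enum _)); rewrite -expr2 sqrf_eq0.
Qed.

Lemma dot_gt0 x : x != 0 -> 0 < dot x x.
Proof.
rewrite -dot_eq0 lt_neqAle eq_sym => -> /=.
by apply: sumr_ge0 => j _; rewrite -expr2 sqr_ge0.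
Qed.

Lemma dot_delta x j : dot (delta_mx 0 j) x = x 0 j.
Proof.
rewrite /dot (bigD1 j) //= big1 ?addr0 => [|k /negPf kj]; rewrite mxE ?eqxx ?mul1r //.
by rewrite kj andbF mul0r.
Qed.

End DotProduct.

(** Indexed with the default value 0, as in [orient], so that the determinants
    that orient cells are determinants of such matrices. *)
Definition rows_mx (R : realType) p (L : seq 'rV[R]_p) : 'M[R]_p :=
  \matrix_(l < p) nth 0 L l.

Section RowsMx.
Variables (R : realType) (p : nat).
Implicit Types (x y z : 'rV[R]_p.+1) (L : seq 'rV[R]_p.+1).

(** Both determinants have the same Laplace expansion along the row [x], except
    that the position of that row shifts every sign. *)
Lemma det_rows_mx_move L1 L2 x : (size L1 <= p)%N ->
  \det (rows_mx (L1 ++ x :: L2)) =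
  (-1) ^+ size L1 * \det (rows_mx (x :: L1 ++ L2)).
Proof.
move=> sL; pose q : 'I_p.+1 := inord (size L1).
have qE : q = size L1 :> nat by rewrite inordK.
rewrite (expand_det_row _ q) (expand_det_row (rows_mx (x :: _)) ord0) mulr_sumr.
apply: eq_bigr => j _.
have -> : rows_mx (L1 ++ x :: L2) q j = x 0 j.
  by rewrite !mxE nth_cat qE ltnn subnn.
have -> : rows_mx (x :: L1 ++ L2) ord0 j = x 0 j by rewrite !mxE.
rewrite [RHS]mulrCA; congr (_ * _); rewrite /cofactor qE exprD [RHS]mulrA.
congr (_ * \det _); apply/matrixP => k l; rewrite !mxE /= /bump /= qE.
rewrite !nth_cat; case: (leqP (size L1) k) => [le|lt]; last by rewrite add0n lt.
by rewrite add1n ltnNge ltnW ?ltnS //= subSn.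
Qed.

(** The generalized cross product of the vectors of [L]; the row 0 does not
    enter the cofactors. *)
Definition cofactor_vec L : 'rV[R]_p.+1 :=
  \row_j cofactor (rows_mx (0 :: L)) ord0 j.

Lemma dot_cofactor_vec x L : dot x (cofactor_vec L) = \det (rows_mx (x :: L)).
Proof.
rewrite (expand_det_row _ ord0); apply: eq_bigr => j _.
rewrite !mxE; congr (_ * (_ * \det _)); apply/matrixP => k l.
by rewrite !mxE /= /bump.
Qed.

Lemma dot_cofactor_vec_mem y L : y \in L -> (size L <= p)%N ->
  dot y (cofactor_vec L) = 0.
Proof.
move=> yL sL; rewrite dot_cofactor_vec.
have iy : (index y L < size L)%N by rewrite index_mem.
pose q : 'I_p.+1 := inord (index y L).+1.
have qE : q = (index y L).+1 :> nat by rewrite inordK // ltnS (leq_trans iy).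
apply: (@determinant_alternate _ _ _ ord0 q) => [|j].
  by rewrite -val_eqE /= qE.
by rewrite !mxE qE /= nth_index.
Qed.

End RowsMx.

Section Independence.
Variables (R : realType) (n m : nat) (B : 'M[int]_(n, m.+1)).
Local Notation b := (normal R B).
Implicit Types (S T : {set 'I_n}) (x y z l : 'rV[R]_m.+1).

Definition indep S := forall c : 'I_n -> R,
  \sum_(i in S) c i *: b i = 0 -> forall i, i \in S -> c i = 0.

Definition indep_mx S : 'M[R]_(#|S|, m.+1) := \matrix_(k < #|S|) b (enum_val k).

Lemma indep_mx_sum S (c : 'rV[R]_#|S|) (c' : 'I_n -> R) :
  (forall k, c 0 k = c' (enum_val k)) ->
  c *m indep_mx S = \sum_(i in S) c' i *: b i.
Proof.
move=> cE; rewrite mulmx_sum_row [RHS]big_enum_val; apply: eq_bigr => k _.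
by rewrite cE rowK.
Qed.

Lemma indep_row_free S : indep S -> row_free (indep_mx S).
Proof.
move=> iS; rewrite -kermx_eq0; apply/rowV0P => v; rewrite sub_kermx => /eqP v0.
case: (pickP (mem S)) => [i0 i0S|S0]; last first.
  have S0' : #|S| = 0 by apply: eq_card0.
  by apply/rowP => k; case: k => k lk; exfalso; rewrite S0' in lk.
pose c' i := v 0 (enum_rank_in i0S i).
have cE k : v 0 k = c' (enum_val k) by rewrite /c' enum_valK_in.
move: v0; rewrite (indep_mx_sum cE) => /iS c0.
by apply/rowP => k; rewrite cE mxE c0 // enum_valP.
Qed.


Lemma indep_sub S T : T \subset S -> indep S -> indep T.
Proof.
move=> TS iS c c0 i iT.
have {c0} /iS : \sum_(j in S) (if j \in T then c j else 0) *: b j = 0.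
  rewrite -[RHS]c0 [RHS]big_mkcond /= big_mkcond /=; apply: eq_bigr => j _.
  case: ifPn => [jS|/(contra (subsetP TS j)) /negPf -> //].
  by case: ifP; rewrite ?scale0r.
by move/(_ i (subsetP TS i iT)); rewrite iT.
Qed.

Lemma indep_card S : indep S -> (#|S| <= m.+1)%N.
Proof. by move=> /indep_row_free /eqP <-; apply: rank_leq_col. Qed.

Lemma indep_solve S (r : 'I_n -> R) : indep S ->
  exists z, forall i, i \in S -> dot (b i) z = r i.
Proof.
move=> /indep_row_free /row_freeP[C BC].
exists (C *m \col_k r (enum_val k))^T => i iS.
rewrite dotE trmxK mulmxA -[i](enum_rankK_in iS) //.
by rewrite -(rowK (fun k => b (enum_val k))) -row_mul BC row1 -rowE !mxE.
Qed.

Lemma indep_kernel S : (#|S| < m.+1)%N ->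
  exists2 z, z != 0 & forall i, i \in S -> dot (b i) z = 0.
Proof.
move=> ltS; have : kermx (indep_mx S)^T != 0.
  by rewrite kermx_eq0 -row_leq_rank mxrank_tr -ltnNge (leq_ltn_trans _ ltS) ?rank_leq_row.
case/rowV0Pn=> z /sub_kermxP z0 nz; exists z => // i iS.
rewrite dotC dotE -[i](enum_rankK_in iS) //.
by rewrite -(rowK (fun k => b (enum_val k))) tr_row colE mulmxA z0 mul0mx mxE.
Qed.

Definition basis_det S : R := \det (rows_mx [seq b j | j <- enum S]).

Definition basis_set S : bool := (#|S| == m.+1) && (basis_det S != 0).

Lemma basis_card S : basis_set S -> #|S| = m.+1. Proof. by case/andP => /eqP. Qed.

Lemma rows_mx_sum S (c : 'I_n -> R) : #|S| = m.+1 ->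
  exists2 v : 'rV[R]_m.+1,
    v *m rows_mx [seq b j | j <- enum S] = \sum_(i in S) c i *: b i
    & v = 0 -> forall i, i \in S -> c i = 0.
Proof.
move=> cS; have sz : size (enum S) = m.+1 by rewrite -cardE.
case: (pickP (mem S)) => [i0 i0S|S0]; last by rewrite eq_card0 in cS.
exists (\row_l c (nth i0 (enum S) l)).
  rewrite mulmx_sum_row -[RHS]big_enum (big_nth i0) sz big_mkord.
  apply: eq_bigr => l _; rewrite mxE rowK (nth_map i0) ?sz //.
move=> v0 i iS; have ltl : (index i (enum S) < m.+1)%N.
  by rewrite -sz index_mem mem_enum.
move/rowP: v0 => /(_ (Ordinal ltl)); rewrite !mxE /=.
by rewrite nth_index ?mem_enum.
Qed.

Lemma basisP S : reflect (#|S| = m.+1 /\ indep S) (basis_set S).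
Proof.
apply: (iffP andP) => [[/eqP cS d0]|[cS iS]].
  split=> // c c0; have [v vE] := rows_mx_sum c cS; apply.
  have uM : rows_mx [seq b j | j <- enum S] \in unitmx by rewrite unitmxE unitfE.
  by rewrite -[v](mulmxK uM) vE c0 mul0mx.
split; first exact/eqP.
rewrite -unitfE -unitmxE -row_free_unit -kermx_eq0; apply/rowV0P => v.
rewrite sub_kermx => /eqP v0; apply/rowP => l; rewrite mxE.
have sz : size (enum S) = m.+1 by rewrite -cardE.
case: (pickP (mem S)) => [i0 i0S|S0]; last by rewrite eq_card0 in cS.
pose c i := v 0 (inord (index i (enum S))).
have cE (k : 'I_m.+1) : c (nth i0 (enum S) k) = v 0 k.
  by rewrite /c index_uniq ?enum_uniq ?sz // inord_val.
rewrite -cE; apply: iS; last by rewrite -mem_enum mem_nth // sz.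
rewrite -{}[RHS]v0 mulmx_sum_row -[LHS]big_enum (big_nth i0) sz big_mkord.
by apply: eq_bigr => k _; rewrite cE rowK (nth_map i0) ?sz.
Qed.

Lemma basis_indep S : basis_set S -> indep S. Proof. by case/basisP. Qed.

Lemma basis_det_neq0 S : basis_set S -> basis_det S != 0.
Proof. by case/andP. Qed.

Lemma basis_expand S l : basis_set S -> exists c, l = \sum_(i in S) c i *: b i.
Proof.
move=> bS; have /indep_row_free := basis_indep bS.
have fS : row_full (indep_mx S) -> exists c, l = \sum_(i in S) c i *: b i.
  case/row_fullP => C CB; have [i0 i0S] : exists i0, i0 \in S.
    by apply/set0Pn; rewrite -card_gt0 (basis_card bS).
  exists (fun i => (l *m C) 0 (enum_rank_in i0S i)).
  rewrite -(indep_mx_sum (c := l *m C)) => [|k]; last by rewrite enum_valK_in.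
  by rewrite -mulmxA CB mulmx1.
by move=> /eqP fr; apply: fS; rewrite /row_full fr (basis_card bS).
Qed.

(** If [T] has [m] elements this is the direction of the line cut out by its
    hyperplanes, and 0 if they are dependent. *)
Definition tau T : 'rV[R]_m.+1 := cofactor_vec [seq b j | j <- enum T].

Lemma enum_split S i : i \in S ->
  exists L1 L2, [/\ enum S = L1 ++ i :: L2, enum (S :\ i) = L1 ++ L2
    & #|[set j in S | (j < i)%N]%SET| = size L1].
Proof.
move=> iS; pose e := enum 'I_n.
have eE (T : {set 'I_n}) : enum T = [seq j <- e | j \in T].
  by rewrite /e !enumT /enum_mem -enumT.
have se : sorted (fun x y : 'I_n => (x < y)%N) e.
  by rewrite /e -(sorted_map (f := val) (e' := ltn)) val_enum_ord iota_ltn_sorted.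
have [L1 [L2 eL]] : exists L1 L2, e = L1 ++ i :: L2.
  have /splitPr[L1 L2] : i \in e by rewrite /e mem_enum.
  by exists L1, L2.
have tr : transitive (fun x y : 'I_n => (x < y)%N) by move=> x y z; apply: ltn_trans.
move: se; rewrite (sorted_pairwise tr) eL pairwise_cat /= => /and3P[].
rewrite allrel_consr => /andP[/allP lt1 _] _ /andP[/allP lt2 _].
exists [seq j <- L1 | j \in S], [seq j <- L2 | j \in S]; split.
- by rewrite eE eL filter_cat /= iS.
- rewrite eE eL filter_cat /=; rewrite !inE eqxx /=; congr (_ ++ _); apply: eq_in_filter.
    by move=> j /lt1; rewrite !inE; case: eqP => // ->; rewrite ltnn.
  by move=> j /lt2; rewrite !inE; case: eqP => // ->; rewrite ltnn.
- rewrite cardE eE eL filter_cat /= !inE ltnn andbF.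
  rewrite (_ : filter _ L2 = [::]) ?cats0; last first.
    apply/eqP; rewrite -(negbK (_ == _)) -has_filter; apply/hasPn => j /lt2 ij /=.
    by rewrite inE ltnNge ltnW ?andbF.
  congr size; apply: eq_in_filter => j /lt1 ji.
  by rewrite !inE ji andbT.
Qed.

(** Moving the row [b i] to the front gives the sign of the simplicial boundary:
    incidence numbers in the nerve become signs of slopes along lines. *)
Lemma basis_det_tau S i : #|S| = m.+1 -> i \in S ->
  basis_det S =
  (-1) ^+ #|[set j in S | (j < i)%N]%SET| * dot (b i) (tau (S :\ i)).
Proof.
move=> cS iS; have [L1 [L2 [eS eSi cE]]] := enum_split iS.
rewrite cE /basis_det eS map_cat /= det_rows_mx_move size_map; last first.
  by move: cS; rewrite cardE eS size_cat /= addnS => -[<-]; rewrite leq_addr.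
by rewrite /tau dot_cofactor_vec eSi map_cat.
Qed.

Lemma tau_mem T j : (#|T| <= m)%N -> j \in T -> dot (b j) (tau T) = 0.
Proof.
move=> cT jT; apply: dot_cofactor_vec_mem; last by rewrite size_map -cardE.
by apply: map_f; rewrite mem_enum.
Qed.

Lemma basis_tau S i : basis_set S -> i \in S -> dot (b i) (tau (S :\ i)) != 0.
Proof.
move=> bS iS; have := basis_det_neq0 bS.
by rewrite (basis_det_tau (basis_card bS) iS) mulf_eq0 negb_or => /andP[].
Qed.

Lemma setD1_card S i : #|S| = m.+1 -> i \in S -> #|S :\ i| = m.
Proof. by move=> cS iS; move: (cardsD1 i S); rewrite iS cS => -[]. Qed.

(** By Cramer's rule this is the sign of the coefficient of [b i] in the
    expansion of [l] over the basis [S] (lemma [esign_coef]). *)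
Definition esign S l i : int :=
  sgz (dot l (tau (S :\ i))) * sgz (dot (b i) (tau (S :\ i))).

Lemma dot_tau_coef S (c : 'I_n -> R) i : #|S| = m.+1 -> i \in S ->
  dot (\sum_(j in S) c j *: b j) (tau (S :\ i)) =
  c i * dot (b i) (tau (S :\ i)).
Proof.
move=> cS iS; rewrite dot_suml (bigD1 i) //= dotZl big1 ?addr0 // => j /andP[jS ji].
by rewrite dotZl tau_mem ?mulr0 ?(setD1_card cS iS) // !inE ji.
Qed.

Lemma esign_coef S (c : 'I_n -> R) i : basis_set S -> i \in S ->
  esign S (\sum_(j in S) c j *: b j) i = sgz (c i).
Proof.
move=> bS iS; rewrite /esign (dot_tau_coef _ (basis_card bS) iS) sgzM -mulrA.
by rewrite sgz_sqr ?basis_tau ?mulr1.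
Qed.

End Independence.

(** * Homology in the top degree *)

Section TopHomology.
Variables (X : based_complex) (k : nat).
Hypothesis top : forall e : chain X, e \in kchains k.+1 -> e = 0.

Lemma boundary_top (z : cycle_group X k) : (z \in boundaries X k) = (z == 0).
Proof.
apply/idP/eqP => [/asboolP[e /top-> zE]|->]; last exact: rpred0.
apply: val_inj; rewrite zE; apply/ffunP => y; rewrite !ffunE.
by apply: big1 => x _; rewrite ffunE mul0r.
Qed.

(** Without boundaries a class has exactly one representative. *)
Definition hrepr (u : homology X k) : chain X := val (repr u : cycle_group X k).

Lemma hrepr_cycle u : hrepr u \in cycles X k.
Proof. exact: (valP (repr u : cycle_group X k)). Qed.

Lemma hreprK u : hclass k (hrepr u) = u.
Proof. by rewrite /hclass /hrepr valKd; apply: reprK. Qed.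

Lemma hclassK c : c \in cycles X k -> hrepr (hclass k c) = c.
Proof.
move=> cc; rewrite /hrepr /hclass -[RHS](insubdK (0 : cycle_group X k) cc).
congr val; apply/eqP; rewrite -subr_eq0 -boundary_top.
by rewrite Quotient.idealrBE reprK.
Qed.

Lemma hreprB u v : hrepr (u - v) = hrepr u - hrepr v.
Proof.
rewrite /hrepr -raddfB; congr val; apply/eqP; rewrite -subr_eq0 -boundary_top.
rewrite Quotient.idealrBE reprK; apply/eqP.
by rewrite -[in LHS](reprK u) -[in LHS](reprK v) raddfB.
Qed.

End TopHomology.

(** * Small perturbations *)

Section SmallMoves.
Variable R : realType.

Lemma finite_small (I : finType) (P : I -> R -> Prop) :
  (forall i, exists2 e, 0 < e & forall a, 0 < a <= e -> P i a) ->
  exists2 e, 0 < e & forall i a, 0 < a <= e -> P i a.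
Proof.
move=> eP; suff [e e0 eE] : exists2 e, 0 < e &
    forall i a, i \in enum I -> 0 < a <= e -> P i a.
  by exists e => // i a; apply: eE; rewrite mem_enum.
elim: (enum I) => [|i s [e e0 IH]]; first by exists 1.
have [e' e'0 iP] := eP i; exists (Num.min e e'); first by rewrite lt_min e0.
move=> k a; rewrite inE le_min => /predU1P[->|ks] /and3P[a0 ae ae'].
  by apply: iP; rewrite a0.
by apply: IH; rewrite ?a0.
Qed.

Lemma sgz_small (c d : R) : c != 0 ->
  exists2 e, 0 < e & forall a, 0 < a <= e -> sgz (c + a * d) = sgz c.
Proof.
move=> c0; have d1 : 0 < `|d| + 1 by rewrite ltr_wpDl.
exists (`|c| / (`|d| + 1)); first by rewrite divr_gt0 ?normr_gt0.
move=> a /andP[a0]; rewrite ler_pdivlMr // => ale.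
have ad : `|a * d| < `|c|.
  by rewrite normrM gtr0_norm // (lt_le_trans _ ale) // mulrDr mulr1 ltrDl.
have [cgt|clt|c00] := ltrgtP c 0; last by rewrite c00 eqxx in c0.
  rewrite !ltr0_sgz //; move: ad; rewrite (ltr0_norm cgt) ltr_norml => /andP[*]; lra.
rewrite !gtr0_sgz //; move: ad; rewrite (gtr0_norm clt) ltr_norml => /andP[*]; lra.
Qed.

(** A small multiple of the new vector repairs the new condition without
    disturbing the others. *)
Lemma avoid_affine p (L : seq ('rV[R]_p * R)) :
  (forall v, v \in L -> v.1 != 0) ->
  exists l : 'rV[R]_p, forall v, v \in L -> dot l v.1 != v.2.
Proof.
elim: L => [_|[v c] L IH nz]; first by exists 0.
have [|l lP] := IH; first by move=> w wL; apply: nz; rewrite inE wL orbT.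
have v0 : v != 0 by apply: (nz (v, c)); rewrite mem_head.
have /finite_small[e e0 eP] : forall w : seq_sub ((v, c) :: L), exists2 e, 0 < e &
    forall a, 0 < a <= e -> dot (l + a *: v) (val w).1 != (val w).2.
  move=> [[w d] /= wL]; have [lw|lw] := eqVneq (dot l w) d.
    exists 1 => // a /andP[a0 _]; rewrite dotDl dotZl lw -subr_eq0 addrAC subrr.
    move: wL; rewrite add0r inE => /predU1P[[-> _]|/lP]; last by rewrite lw eqxx.
    by rewrite mulf_neq0 ?gt_eqF ?dot_gt0.
  have [|e e0 eP] := @sgz_small (dot l w - d) (dot v w); first by rewrite subr_eq0.
  exists e => // a ae; rewrite -subr_eq0 dotDl dotZl addrAC -sgz_eq0 eP //.
  by rewrite sgz_eq0 subr_eq0.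
exists (l + e *: v) => w wL.
by apply: (eP (SeqSub wL)); rewrite e0 lexx.
Qed.

(** The real line is connected. *)
Lemma locally_constant_pred (P : R -> Prop) :
  (forall t, exists2 e, 0 < e & forall u, `|u - t| < e -> P u <-> P t) ->
  forall t u, P t -> P u.
Proof.
move=> lc t u Pt; have cT : connected [set: R]%classic by apply/connected_intervalP.
suff PT : [set x | P x]%classic = [set: R]%classic.
  by have : [set: R]%classic u by []; rewrite -PT.
have oP (Q : R -> Prop) : (forall t u, (P u <-> P t) -> Q t -> Q u) ->
    open [set x | Q x]%classic.
  move=> QP; rewrite openE => x Qx; apply/nbhs_ballP; have [e e0 eP] := lc x.
  exists e => // y xy; apply: (QP x) => //; apply: eP.
  by rewrite distrC; move: xy; rewrite /ball /=.
apply: cT; first by exists t.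
  exists [set x | P x]%classic; last by rewrite classical_sets.setTI.
  by apply: oP => x y [].
exists [set x | P x]%classic; last by rewrite classical_sets.setTI.
rewrite -openC; apply: (oP (fun x => ~ P x)) => x y [yx xy] nx /yx; exact: nx.
Qed.

End SmallMoves.

(** * Cells of a simple arrangement as sign vectors *)

Section Cells.
Variables (R : realType) (n m : nat) (B : 'M[int]_(n, m.+1)) (psi : 'cV[int]_n).
Local Notation b := (normal R B).
Local Notation aff := (affine_form B psi).
Local Notation tau := (@tau R n m B).
Local Notation basis_set := (@basis_set R n m B).
Local Notation indep := (@indep R n m B).
Local Notation esign := (@esign R n m B).
Implicit Types (x y z l : 'rV[R]_m.+1) (i : 'I_n) (s t v : covector n).
Implicit Types (S T : {set 'I_n}).

Lemma affE i x : aff i x = dot (b i) x + (psi i 0)%:~R.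
Proof. by congr (_ + _); apply: eq_bigr => j _; rewrite !mxE. Qed.

Lemma affD i x z : aff i (x + z) = aff i x + dot (b i) z.
Proof. by rewrite !affE dotDr addrAC. Qed.

Lemma aff_line i x z (a : R) : aff i (x + a *: z) = aff i x + a * dot (b i) z.
Proof. by rewrite affD dotZr. Qed.

Lemma sign_val_inj : injective sign_val.
Proof. by move=> [[]|] [[]|]. Qed.

Definition sgn_opt (a : R) : option bool :=
  if a == 0 then None else Some (0 < a).

Lemma sgn_optE (a : R) : sign_val (sgn_opt a) = sgz a.
Proof.
rewrite /sgn_opt; have [->|a0] := eqVneq a 0; first by rewrite sgz0.
have [a_lt0|a_gt0|a00] := ltrgtP a 0 => /=.
- by rewrite ltr0_sgz.
- by rewrite gtr0_sgz.
- by rewrite a00 eqxx in a0.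
Qed.

Definition cov x : covector n := [ffun i => sgn_opt (aff i x)].

Lemma cov_val x i : sign_val (cov x i) = sgz (aff i x).
Proof. by rewrite ffunE sgn_optE. Qed.

Lemma cov_None x i : (cov x i == None) = (aff i x == 0).
Proof. by rewrite ffunE /sgn_opt; case: ifP. Qed.

Lemma covP x s : (forall i, sgz (aff i x) = sign_val (s i)) <-> s = cov x.
Proof.
split=> [sE|-> i]; last by rewrite cov_val.
by apply/ffunP => i; apply: sign_val_inj; rewrite -sE cov_val.
Qed.

Lemma cellE s x : cell B psi s x <-> s = cov x.
Proof. exact: covP. Qed.

Definition realizable s := exists x, s = cov x.

Lemma realizableE s : (@cell R n m.+1 B psi s !=set0)%classic <-> realizable s.
Proof. by split=> -[x /cellE]; exists x. Qed.

(** The face order of the arrangement, read off the sign vectors. *)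
Definition preceq s t := [forall i, (s i == None) || (s i == t i)].

Lemma preceqP s t : reflect (forall i, s i = None \/ s i = t i) (preceq s t).
Proof.
apply: (iffP forallP) => st i.
  by have /orP[/eqP sN|/eqP sE] := st i; [left | right].
by have [->|->] := st i; rewrite eqxx ?orbT.
Qed.

Lemma preceq_refl s : preceq s s.
Proof. by apply/preceqP => i; right. Qed.

Lemma preceq_trans t s u : preceq s t -> preceq t u -> preceq s u.
Proof.
move=> /preceqP st /preceqP tu; apply/preceqP => i.
by case: (st i) => ->; [left | apply: tu].
Qed.

Lemma zerosE s i : (i \in zeros s) = (s i == None).
Proof. by rewrite inE. Qed.

Lemma preceq_zeros s t : preceq s t -> zeros t \subset zeros s.
Proof.
move=> /preceqP st; apply/subsetP => i; rewrite !zerosE => /eqP ti.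
by case: (st i) => ->; rewrite ?ti eqxx.
Qed.

Lemma preceq_notin s t i : preceq s t -> i \notin zeros s -> t i = s i.
Proof. by rewrite zerosE => /preceqP/(_ i)[->|->]. Qed.

Lemma preceq_eq s t : preceq s t -> zeros s \subset zeros t -> s = t.
Proof.
move=> st /subsetP zst; apply/ffunP => i.
have [iz|iz] := boolP (i \in zeros s); last by rewrite (preceq_notin st iz).
by move: iz (zst i iz); rewrite !zerosE => /eqP-> /eqP->.
Qed.

Lemma small_move x z : exists2 e, 0 < e & forall a, 0 < a <= e ->
  forall i, aff i x != 0 -> sgz (aff i (x + a *: z)) = sgz (aff i x).
Proof.
have [i|e e0 eP] := @finite_small _ 'I_n (fun i a => aff i x != 0 ->
  sgz (aff i (x + a *: z)) = sgz (aff i x)).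
  have [->|ai] := eqVneq (aff i x) 0; first by exists 1.
  by have [e e0 eE] := sgz_small (dot (b i) z) ai; exists e => // a /eE; rewrite aff_line.
by exists e => // a ae i; apply: eP.
Qed.

Lemma move_into x z s : preceq (cov x) s ->
  (forall i, aff i x = 0 -> sgz (dot (b i) z) = sign_val (s i)) ->
  exists2 e, 0 < e & forall a, 0 < a <= e -> s = cov (x + a *: z).
Proof.
move=> /preceqP xs zs; have [e e0 eP] := small_move x z; exists e => // a ae.
apply/covP => i; have [ai|ai] := eqVneq (aff i x) 0.
  rewrite aff_line ai add0r sgzM zs // gtr0_sgz ?mul1r //.
  by case/andP: ae.
rewrite eP // -cov_val; case: (xs i) => [/eqP|->//].
by rewrite cov_None (negPf ai).
Qed.

Definition cell_bounded s :=
  exists M : R, forall x, s = cov x -> forall j, `|x 0 j| <= M.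

Lemma bounded_cellE s :
  bounded_cell R B psi s <-> realizable s /\ cell_bounded s.
Proof.
rewrite /bounded_cell realizableE; split=> -[rs bs]; split=> //.
  have [M [_ /(_ (M + 1))]] := bs; rewrite ltrDl ltr01 => /(_ isT) bM.
  exists (M + 1) => x /cellE /bM xM j; apply: le_trans xM => /=.
  rewrite [leRHS]/Num.norm /= mx_normrE.
  exact: (le_bigmax _ (fun ij : 'I_1 * 'I_m.+1 => `|x ij.1 ij.2|) (0, j)).
have [M bM] := bs; exists `|M|; split; first exact: num_real.
move=> N ltN x /cellE sx; rewrite /= [leLHS]/Num.norm /= mx_normrE.
apply: bigmax_le => [|[i j] _ /=]; first by rewrite (le_trans _ (ltW ltN)).
by rewrite ord1 (le_trans (bM _ sx j)) // (le_trans (ler_norm M)) // ltW.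
Qed.

Lemma sgzD (a c : R) : sgz a = sgz c -> sgz (a + c) = sgz c.
Proof.
move=> ac; have [c0|c0|c0] := ltrgtP c 0.
- move: ac; rewrite !(ltr0_sgz c0) => /eqP; rewrite sgz_cp0 => a0.
  by rewrite ltr0_sgz //; lra.
- move: ac; rewrite !(gtr0_sgz c0) => /eqP; rewrite sgz_cp0 => a0.
  by rewrite gtr0_sgz //; lra.
- by move: ac; rewrite c0 sgz0 => /eqP; rewrite sgz_cp0 => /eqP->; rewrite addr0 sgz0.
Qed.

(** The midpoint of a point of the face and a fixed point of the cell lies in
    the cell. *)
Lemma cell_bounded_face t s : preceq t s -> realizable s ->
  cell_bounded s -> cell_bounded t.
Proof.
move=> ts [y sy] [M bM]; exists (2 * M + \sum_j `|y 0 j|) => x tx j.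
have sxy : s = cov (2^-1 *: (x + y)).
  apply/covP => i; have -> : aff i (2^-1 *: (x + y)) = (aff i x + aff i y) / 2.
    rewrite !affE dotZr dotDr; lra.
  rewrite sgzM [sgz 2^-1]gtr0_sgz ?invr_gt0 ?ltr0n // mulr1 sy cov_val.
  have [|ti] := preceqP _ _ ts i; last by apply: sgzD; rewrite -!cov_val -tx -sy ti.
  by move=> /eqP; rewrite tx cov_None => /eqP->; rewrite add0r.
have yj : `|y 0 j| <= \sum_j `|y 0 j|.
  by rewrite (bigD1 j) //= lerDl sumr_ge0.
have := bM _ sxy j; rewrite !mxE normrM gtr0_norm ?invr_gt0 ?ltr0n // => le.
have -> : x 0 j = (x 0 j + y 0 j) - y 0 j by rewrite addrK.
rewrite (le_trans (ler_normB _ _)) // lerD // mulrC -ler_pdivrMr ?ltr0n //.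
by rewrite mulrC.
Qed.

Lemma aff_continuous i : continuous (fun x => aff i x).
Proof.
move=> x; apply: (@cvgD _ R^o _ (nbhs x) (nbhs_filter x)); last exact: cvg_cst.
apply: (@cvg_big R) => [|j _]; first exact: add_continuous.
by apply: cvgMl_tmp; apply: coord_continuous.
Qed.

(** By continuity a point of the closure of a cell has the sign of that cell
    wherever it is not on a hyperplane. Conversely, moving from a point of the
    face towards a point of the cell enters the cell at once. *)
Lemma faceE t s : realizable s ->
  face R B psi t s <-> realizable t /\ preceq t s.
Proof.
move=> [y sy]; rewrite /face realizableE; split=> -[rt ts]; split=> //.
  have [x tx] := rt; apply/preceqP => i.
  have xs : topology_structure.closure (cell B psi s) x by apply: ts; apply/cellE.
  have [ai|ai] := eqVneq (aff i x) 0; [left|right].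
    by apply/eqP; rewrite tx cov_None ai.
  have [|z [/cellE sz /=]] := xs [set z | 0 < aff i z * aff i x]%classic.
    apply: (@cvgr_gt _ _ (nbhs x) (nbhs_filter x) _ (aff i x * aff i x)).
      by apply: cvgMr_tmp; apply: aff_continuous.
    by rewrite -expr2 lt_neqAle eq_sym sqrf_eq0 ai sqr_ge0.
  move=> pos; apply: sign_val_inj; rewrite tx sz !cov_val.
  have /eqP := gtr0_sgz pos; rewrite sgzM => /eqP zx.
  by rewrite -[LHS]mul1r -zx -mulrA sgz_sqr // mulr1.
move=> x /cellE tx A /nbhs_ballP [e /= e0 eA].
have [|i ai|e1 e10 e1P] := @move_into x (y - x) s; first by rewrite -tx.
  rewrite sy cov_val dotBr; congr sgz; move: ai; rewrite !affE; lra.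
pose D := \sum_j `|(y - x) 0 j| + 1.
have D0 : 0 < D by rewrite ltr_wpDl // sumr_ge0.
pose a := Num.min e1 (e / 2 / D).
have a0 : 0 < a by rewrite lt_min e10 !divr_gt0.
exists (x + a *: (y - x)); split.
  by apply/cellE; rewrite -e1P // a0 ge_min lexx.
apply: eA; split=> // k j; rewrite ord1 /ball /= [(x + _) _ _]mxE opprD addNKr.
rewrite normrN mxE normrM gtr0_norm //.
apply: (@le_lt_trans _ _ (e / 2)); last by rewrite ltr_pdivrMr // ltr_pMr // ltr1n.
have aD : a * D <= e / 2 by rewrite -ler_pdivlMr // ge_min lexx orbT.
apply: le_trans aD; rewrite ler_pM2l // /D (bigD1 j) //= -addrA lerDl.
by rewrite addr_ge0 // sumr_ge0.
Qed.

(** A ray inside a bounded cell has to leave it, and it does so through the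
    first hyperplane that it meets. *)
Lemma ray_exit x z : cell_bounded (cov x) -> z != 0 ->
  (forall i, aff i x = 0 -> dot (b i) z = 0) ->
  exists2 a, 0 < a & preceq (cov (x + a *: z)) (cov x) /\
    exists i, aff i x != 0 /\ aff i (x + a *: z) = 0.
Proof.
move=> [M bM] z0 zx; pose bad i := aff i x * dot (b i) z < 0.
pose r i := - (aff i x / dot (b i) z).
have r0 i : bad i -> 0 < r i.
  move=> bi; have d0 : dot (b i) z != 0.
    by apply: contraTneq bi => d0; rewrite /bad d0 mulr0 ltxx.
  rewrite /r oppr_gt0 -(pmulr_llt0 (x := dot (b i) z ^+ 2)); last first.
    by rewrite lt_neqAle eq_sym sqrf_eq0 d0 sqr_ge0.
  by rewrite expr2 -mulrA mulKf // mulrC.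
have keep a k : 0 < a -> (bad k -> a < r k) ->
    sgz (aff k (x + a *: z)) = sgz (aff k x).
  move=> a0 ar; rewrite aff_line.
  have [xk|xk] := eqVneq (aff k x) 0; first by rewrite xk zx // mulr0 addr0.
  have [bk|] := boolP (bad k).
    have := ar bk; rewrite /r; have : dot (b k) z != 0.
      by apply: contraTneq bk => d0; rewrite /bad d0 mulr0 ltxx.
    move: bk; rewrite /bad; have [x0|x0|x0] := ltrgtP (aff k x) 0.
    - rewrite nmulr_rlt0 // => d0 _; rewrite -mulNr ltr_pdivlMr // => lt.
      by rewrite !ltr0_sgz //; lra.
    - rewrite pmulr_rlt0 // => d0 _; rewrite -mulNr ltr_ndivlMr // => lt.
      by rewrite !gtr0_sgz //; lra.
    - by rewrite x0 eqxx in xk.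
  rewrite /bad -leNgt; have [x0|x0|x0] := ltrgtP (aff k x) 0.
  - rewrite nmulr_rge0 // => d0; have : a * dot (b k) z <= 0 by rewrite pmulr_rle0.
    by move=> le; rewrite !ltr0_sgz //; lra.
  - rewrite pmulr_rge0 // => d0; have : 0 <= a * dot (b k) z by rewrite pmulr_rge0.
    by move=> le; rewrite !gtr0_sgz //; lra.
  - by rewrite x0 eqxx in xk.
have [i0 bi0|nobad] := pickP bad; last first.
  have [j zj] : exists j, z 0 j != 0 by apply/rV0Pn.
  have z1 : 0 < `|z 0 j| by rewrite normr_gt0.
  pose a := (`|M| + 1 + `|x 0 j|) / `|z 0 j|.
  have a0 : 0 < a by rewrite divr_gt0 // ltr_wpDr // ltr_wpDl.
  have /bM/(_ j) : cov x = cov (x + a *: z).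
    by apply/covP => k; rewrite keep ?nobad // cov_val.
  have : a * `|z 0 j| = `|M| + 1 + `|x 0 j| by rewrite divfK ?gt_eqF.
  rewrite !mxE => aE le; have := ler_norm M.
  have := lerB_normD (a * z 0 j) (x 0 j).
  rewrite normrM (gtr0_norm a0) (addrC (a * z 0 j)) => le1 le2; lra.
case: (arg_minP r bi0) => i bi imin; exists (r i); first exact: r0.
have di0 : dot (b i) z != 0.
  by apply: contraTneq bi => d0; rewrite /bad d0 mulr0 ltxx.
have xi0 : aff i x != 0.
  by apply: contraTneq bi => d0; rewrite /bad d0 mul0r ltxx.
have zero k : bad k -> r k = r i -> aff k (x + r i *: z) = 0.
  move=> bk <-; rewrite aff_line /r mulNr divfK ?subrr //.
  by apply: contraTneq bk => d0; rewrite /bad d0 mulr0 ltxx.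
split; last by exists i; split=> //; apply: zero.
apply/preceqP => k; have [/andP[bk /eqP rk]|nk] := boolP (bad k && (r k == r i)).
  by left; apply/eqP; rewrite cov_None zero.
right; apply: sign_val_inj; rewrite !cov_val keep ?r0 // => bk.
by rewrite lt_neqAle imin // andbT eq_sym; apply: contraNneq nk => ->; rewrite bk /=.
Qed.
Lemma sgz_sign (o : option bool) : sgz ((sign_val o)%:~R : R) = sign_val o.
Proof. by case: o => [[]|] /=; rewrite ?mulrN1z ?sgzN1 ?sgz1 ?sgz0. Qed.

(** The arrangement is simple: hyperplanes with a common point are
    independent. *)
Hypothesis simple : forall x, indep (zeros (cov x)).

Lemma indep_zeros s : realizable s -> indep (zeros s).
Proof. by case=> x ->. Qed.

(** Along independent hyperplanes the signs can be prescribed: some direction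
    leads from a point of [t] to the required sides. *)
Lemma realizable_up t s : realizable t -> preceq t s -> realizable s.
Proof.
move=> [x ->] xs.
have [z zP] := indep_solve (fun i => (sign_val (s i))%:~R) (@simple x).
have [i ai|e e0 eP] := move_into xs (z := z).
  by rewrite zP ?sgz_sign // zerosE cov_None ai.
by exists (x + e *: z); apply: eP; rewrite e0 lexx.
Qed.

(** * Vertices and edges *)

Definition vpt S : 'rV[R]_m.+1 :=
  xget 0 [set x | forall i, i \in S -> aff i x = 0]%classic.

Definition vtx S : covector n := cov (vpt S).

Lemma vptP S i : basis_set S -> i \in S -> aff i (vpt S) = 0.
Proof.
move=> bS iS; rewrite /vpt; case: xgetP => [x _ /(_ i iS) //|xno].
have [z zP] := indep_solve (fun i => - (psi i 0)%:~R) (basis_indep bS).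
by case: (xno z) => j jS; rewrite affE zP // addNr.
Qed.

Lemma vpt_unique S x : basis_set S -> (forall i, i \in S -> aff i x = 0) -> x = vpt S.
Proof.
move=> bS xS; apply/eqP; rewrite -subr_eq0 -dot_eq0.
have [c cE] := basis_expand (x - vpt S) bS.
rewrite {1}cE dot_suml big1 // => i iS; rewrite dotZl dotBr.
have := vptP bS iS; have := xS _ iS; rewrite !affE => x1 x2.
by rewrite (_ : dot _ _ - _ = 0) ?mulr0 //; lra.
Qed.

Lemma zeros_full S x : basis_set S -> S \subset zeros (cov x) -> zeros (cov x) = S.
Proof.
move=> bS Sx; apply/esym/eqP; rewrite eqEcard Sx (basis_card bS).
exact: indep_card (@simple x).
Qed.

Lemma zeros_vtx S : basis_set S -> zeros (vtx S) = S.
Proof.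
move=> bS; apply: zeros_full => //; apply/subsetP => i iS.
by rewrite zerosE cov_None vptP.
Qed.

Lemma vtx_zeros s : realizable s -> (m < #|zeros s|)%N ->
  basis_set (zeros s) /\ s = vtx (zeros s).
Proof.
move=> [x ->] lt; have bx : basis_set (zeros (cov x)).
  by apply/basisP; split; [apply/anti_leq; rewrite lt (indep_card (@simple x))|].
split=> //; congr cov; apply: vpt_unique => // i.
by rewrite zerosE cov_None => /eqP.
Qed.

Lemma realizable_vtx S : realizable (vtx S). Proof. by exists (vpt S). Qed.

(** As long as the hyperplanes through a point leave a direction free, a ray in
    that direction meets one more of them. *)
Lemma bounded_has_vertex s : realizable s -> cell_bounded s ->
  exists2 S, basis_set S & preceq (vtx S) s.
Proof.
have [k] := ubnP (m.+1 - #|zeros s|); elim: k s => // k IH s lek rs bs.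
have [lt|ge] := leqP #|zeros s| m; last first.
  by have [bS sE] := vtx_zeros rs ge; exists (zeros s); rewrite -?sE ?preceq_refl.
have [z z0 zs] := @indep_kernel R n m B (zeros s) lt.
have [x sx] := rs; rewrite {}sx in bs zs lek lt *.
have [|a a0 [xs [i [xi xai]]]] := ray_exit bs z0.
  by move=> i xi; apply: zs; rewrite zerosE cov_None xi.
have [| | |S bS Ss] := IH (cov (x + a *: z)).
- apply: leq_trans (lek : (_ <= k)%N); rewrite ltn_sub2l //.
  apply: proper_card; rewrite properE (preceq_zeros xs) /=.
  by apply/subsetPn; exists i; rewrite zerosE cov_None ?xai.
- by exists (x + a *: z).
- by apply: cell_bounded_face xs _ bs; exists x.
by exists S => //; apply: preceq_trans xs.
Qed.

(** If [l] decreased along an edge of the cell that starts at [S], the other end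
    of this edge would be a lower vertex. *)
Lemma min_vertex_sign s l S i : realizable s -> cell_bounded s -> basis_set S ->
  preceq (vtx S) s ->
  (forall S', basis_set S' -> preceq (vtx S') s -> dot l (vpt S) <= dot l (vpt S')) ->
  i \in S -> s i != None -> dot l (tau (S :\ i)) != 0 ->
  esign S l i = sign_val (s i).
Proof.
move=> rs bs bS Ss minS iS si li.
have [c cE] := basis_expand l bS; rewrite {1}cE esign_coef //.
have ci : c i != 0.
  by apply: contraNneq li => ci; rewrite cE dot_tau_coef ?(basis_card bS) // ci mul0r.
have [w wP] := indep_solve (fun j => (sign_val (s i))%:~R * (j == i)%:R) (basis_indep bS).
have lw : dot l w = c i * (sign_val (s i))%:~R.
  rewrite cE dot_suml (bigD1 i) //= dotZl wP // eqxx mulr1 big1 ?addr0 //.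
  by move=> j /andP[jS /negPf ji]; rewrite dotZl wP // ji !mulr0.
have si0 : ((sign_val (s i))%:~R : R) != 0 by rewrite intr_eq0; case: (s i) si => [[]|].
suff lw0 : 0 <= dot l w.
  have : 0 < dot l w by rewrite lt_neqAle lw0 eq_sym lw mulf_neq0.
  rewrite lw => /gtr0_sgz; rewrite sgzM sgz_sign; case: (s i) si => [[]|] //= _.
    by rewrite mulr1.
  by rewrite mulrN1 => <-; rewrite opprK.
(* The edge of [s] that leaves the vertex [S] away from the [i]-th hyperplane. *)
pose e : covector n := [ffun j => if j == i then s i else vtx S j].
have eE j : e j = if j == i then s i else vtx S j by rewrite ffunE.
have Se : preceq (vtx S) e.
  apply/preceqP => j; rewrite eE; case: eqP => [->|_]; last by right.
  by left; apply/eqP; rewrite cov_None vptP.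
have es : preceq e s.
  by apply/preceqP => j; rewrite eE; case: eqP => [->|_]; [right|apply: (preceqP _ _ Ss)].
have be : cell_bounded e by apply: cell_bounded_face es _ bs.
have ze : zeros e = S :\ i.
  apply/setP => j; rewrite zerosE eE !inE.
  have [->|_] /= := eqVneq j i; first exact: negPf.
  by rewrite -zerosE zeros_vtx.
have [j vj|a a0 aP] := move_into Se (z := w).
  have jS : j \in S by rewrite -(zeros_vtx bS) zerosE cov_None vj.
  rewrite wP // sgzM sgz_sign eE; case: eqP => _ /=; first by rewrite sgz1 mulr1.
  by rewrite sgz0 mulr0 (_ : vtx S j = None) //; apply/eqP; rewrite -zerosE zeros_vtx.
have ea := aP a; rewrite a0 lexx in ea; have {aP}ea := ea isT.
have w0 : w != 0 by apply: contraNneq si0 => w0; have := wP i iS; rewrite w0 dot0r eqxx mulr1 => <-.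
rewrite ea in be.
have [j aj|a' a'0 [ye [j [aj yj]]]] := ray_exit be w0.
  have : j \in S :\ i by rewrite -ze ea zerosE cov_None aj.
  by rewrite !inE => /andP[/negPf ji jS]; rewrite wP // ji mulr0.
set y := _ + a' *: w in ye yj.
have zlt : (m < #|zeros (cov y)|)%N.
  rewrite -(setD1_card (basis_card bS) iS) -ze ea; apply: proper_card.
  rewrite properE preceq_zeros //=; apply/subsetPn; exists j.
    by rewrite zerosE cov_None yj.
  by rewrite zerosE cov_None.
have [by' yE] := vtx_zeros (ex_intro _ y erefl) zlt.
have ypt : y = vpt (zeros (cov y)).
  by apply: vpt_unique => // k; rewrite zerosE cov_None => /eqP.
have := minS _ by'; rewrite -yE -ypt => /(_ (preceq_trans ye _)).
rewrite -ea => /(_ es); rewrite /y !dotDr !dotZr -addrA lerDl -mulrDl.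
by rewrite pmulr_rge0 // addr_gt0.
Qed.

(** [l] is not constant on any line of the arrangement that has a vertex. *)
Definition generic l := forall S i, basis_set S -> i \in S -> dot l (tau (S :\ i)) != 0.

Lemma min_vertex s l : realizable s -> cell_bounded s -> exists S,
  [/\ basis_set S, preceq (vtx S) s &
   forall S', basis_set S' -> preceq (vtx S') s -> dot l (vpt S) <= dot l (vpt S')].
Proof.
move=> rs bs; have [S0 bS0 S0s] := bounded_has_vertex rs bs.
have P0 : basis_set S0 && preceq (vtx S0) s by rewrite bS0.
case: (arg_minP (P := fun S => basis_set S && preceq (vtx S) s) (fun S => dot l (vpt S)) P0).
move=> S /andP[bS Ss] minS; exists S; split=> // S' bS' S's.
by apply: minS; rewrite bS'.
Qed.

Lemma generic_exists (L : seq ('rV[R]_m.+1 * R)) :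
  (forall w, w \in L -> w.1 != 0) ->
  exists2 l, generic l & forall w, w \in L -> dot l w.1 != w.2.
Proof.
move=> L0; pose G := [seq (tau (Si.1 :\ Si.2), 0 : R) |
  Si <- enum [pred Si : {set 'I_n} * 'I_n | basis_set Si.1 && (Si.2 \in Si.1)]].
have [|l lP] := @avoid_affine R m.+1 (G ++ L).
  move=> v; rewrite mem_cat => /orP[/mapP[[S i] + ->]|]; last exact: L0.
  rewrite mem_enum inE /= => /andP[bS iS].
  by apply: contraTneq (basis_tau bS iS) => ->; rewrite dot0r eqxx.
exists l => [S i bS iS|v vL]; last by apply: lP; rewrite mem_cat vL orbT.
apply: (lP (tau (S :\ i), 0)); rewrite mem_cat; apply/orP; left.
by apply/mapP; exists (S, i) => //; rewrite mem_enum inE /= bS.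
Qed.

(** The face of [s] on the line of [T] is a segment: the terms at its two ends
    are opposite, being the signs of the slopes of [l] and of [- l]. *)
Lemma edge_sum s T : realizable s -> cell_bounded s -> #|T| = m ->
  zeros s \subset T ->
  \sum_(i | [&& i \notin T, basis_set (i |: T) & preceq (vtx (i |: T)) s])
     sign_val (s i) * sgz (dot (b i) (tau T)) = 0.
Proof.
move=> rs bs cT sT.
have [i0 /and3P[i0T bi0 i0s]|none] := pickP (fun i => [&& i \notin T, basis_set (i |: T)
  & preceq (vtx (i |: T)) s]); last by rewrite big1 // => i; rewrite none.
pose e : covector n := [ffun j => if j \in T then None else s j].
have eE j : e j = if j \in T then None else s j by rewrite ffunE.
have es : preceq e s by apply/preceqP => j; rewrite eE; case: ifP; [left|right].
have vs i : i \notin T -> basis_set (i |: T) -> preceq (vtx (i |: T)) s -> preceq (vtx (i |: T)) e.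
  move=> iT bi vs; apply/preceqP => j; rewrite eE; case: ifP => [jT|_].
    by left; apply/eqP; rewrite -zerosE zeros_vtx // !inE jT orbT.
  exact: (preceqP _ _ vs).
have re : realizable e := realizable_up (realizable_vtx _) (vs _ i0T bi0 i0s).
have be : cell_bounded e := cell_bounded_face es rs bs.
have ze : zeros e = T.
  apply/setP => j; rewrite zerosE eE; case: ifP => // jT; apply/negbTE.
  by rewrite -zerosE; apply: contraFN jT => /(subsetP sT).
have ext l : generic l -> exists2 i,
    [&& i \notin T, basis_set (i |: T) & preceq (vtx (i |: T)) s] &
    sign_val (s i) * sgz (dot (b i) (tau T)) = sgz (dot l (tau T)).
  move=> gl; have [S [bS Se minS]] := min_vertex l re be.
  have TS : T \subset S by rewrite -ze -(zeros_vtx bS) preceq_zeros.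
  have [i iS iT] : exists2 i, i \in S & i \notin T.
    apply/subsetPn; apply: contraTN (leqnn m.+1) => /subset_leq_card.
    by rewrite (basis_card bS) cT ltnn.
  have SE : S = i |: T.
    apply/esym/eqP; rewrite eqEcard (basis_card bS) cardsU1 iT cT leqnn andbT.
    by rewrite subUset sub1set iS.
  have SiT : S :\ i = T by rewrite SE setU1K.
  exists i; first by rewrite iT -SE bS (preceq_trans Se es).
  have ei : e i = s i by rewrite eE (negPf iT).
  have := min_vertex_sign re be bS Se minS iS; rewrite ei -zerosE.
  rewrite (contra (subsetP sT i) iT) => /(_ isT (gl _ _ bS iS)) <-.
  rewrite /esign SiT -mulrA sgz_sqr ?mulr1 // -SiT; exact: basis_tau.
have [l gl _] := @generic_exists [::] (fun _ => ltac:(by [])).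
have [i iP il] := ext l gl.
have [|k kP kl] := ext (- l).
  by move=> S j bS jS; rewrite dotNl oppr_eq0 gl.
have lT : sgz (dot l (tau T)) != 0.
  case/and3P: iP => iT bi _; rewrite sgz_eq0 -[T](setU1K iT).
  by apply: gl; rewrite // setU11.
(* A segment has only one end in each direction. *)
have uniq i1 i2 (P := fun i => [&& i \notin T, basis_set (i |: T) & preceq (vtx (i |: T)) s]) :
    P i1 -> P i2 -> sign_val (s i1) * sgz (dot (b i1) (tau T)) =
    sign_val (s i2) * sgz (dot (b i2) (tau T)) -> i1 = i2.
  move=> /and3P[i1T b1 s1] /and3P[i2T b2 s2] E12.
  have notz : aff i2 (vpt (i1 |: T)) = 0 -> i1 = i2.
    move=> z; have : i2 \in zeros (vtx (i1 |: T)) by rewrite zerosE cov_None z.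
    by rewrite zeros_vtx // !inE (negPf i2T) orbF => /eqP.
  have [/notz //|z2] := eqVneq (aff i2 (vpt (i1 |: T))) 0; exfalso.
  pose d := vpt (i2 |: T) - vpt (i1 |: T).
  have dE j : dot (b j) d = aff j (vpt (i2 |: T)) - aff j (vpt (i1 |: T)).
    by rewrite /d dotBr !affE; lra.
  have [c cE] := basis_expand (b i2) b1.
  have tE : dot (b i2) (tau T) = c i1 * dot (b i1) (tau T).
    by rewrite cE -[T in tau T](setU1K i1T) dot_tau_coef ?(basis_card b1) ?setU11.
  have : dot (b i2) d = c i1 * dot (b i1) d.
    rewrite {1}cE dot_suml (bigD1 i1) ?setU11 //= dotZl big1 ?addr0 // => j /andP[jT ji].
    have {ji}jT : j \in T by move: jT; rewrite !inE (negPf ji).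
    by rewrite dotZl dE !vptP ?subrr ?mulr0 // !inE jT orbT.
  rewrite !dE (vptP b2 (setU11 _ _)) (vptP b1 (setU11 _ _)) subr0 sub0r => dd.
  have c0 : c i1 != 0 by apply: contraNneq z2 => c0; rewrite -oppr_eq0 dd c0 mul0r.
  have z1 : aff i1 (vpt (i2 |: T)) != 0.
    by apply: contraNneq z2 => z1; rewrite -oppr_eq0 dd z1 mulr0.
  have pos p j : preceq (cov p) s -> aff j p != 0 -> sgz (aff j p) = sign_val (s j).
    move=> /preceqP/(_ j) [/eqP|<- _]; last by rewrite cov_val.
    by rewrite cov_None => ->.
  have := congr1 (fun a : R => sgz a) dd; rewrite sgzN sgzM !pos // => E3.
  move: E12; rewrite tE sgzM mulrA => /(mulIf _).
  rewrite sgz_eq0 -[T in tau T](setU1K i1T) basis_tau ?setU11 // => /(_ isT) E4.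
  move: E3; rewrite E4 mulrCA sgz_sqr // mulr1 -(pos _ _ s1 z2).
  by move/eqP; rewrite eqNr sgz_eq0 (negPf z2).
have ik : k != i.
  apply: contraNneq lT => ki; move: kl; rewrite ki il dotNl sgzN => /eqP.
  by rewrite -subr_eq0 opprK -mulr2n mulrn_eq0.
rewrite (bigD1 i) // (bigD1 k) ?kP //= il kl dotNl sgzN big1 ?addr0 ?subrr //.
move=> j /andP[/andP[jP ji] jk].
have : sign_val (s j) * sgz (dot (b j) (tau T)) \in [:: 0; sgz (dot l (tau T)); - sgz (dot l (tau T))].
  case/and3P: (jP) => jT bj _; have : dot (b j) (tau T) != 0.
    by rewrite -[T in tau T](setU1K jT) basis_tau // setU11.
  move: lT; rewrite !inE; case: (s j) => [[]|];
    do 2!case: sgzP => // _; by rewrite ?mul0r ?mulrN1 ?mul1r ?mulN1r ?opprK ?eqxx ?orbT.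
rewrite !inE => /or3P[/eqP //|/eqP E|/eqP E].
  by move: ji; rewrite (uniq j i jP iP) ?eqxx // E il.
by move: jk; rewrite (uniq j k jP kP) ?eqxx // E kl dotNl sgzN.
Qed.
Lemma sum_setD1 (f : {set 'I_n} -> 'I_n -> int) :
  \sum_(S : {set 'I_n}) \sum_(i in S) f S i =
  \sum_(T : {set 'I_n}) \sum_(i | i \notin T) f (i |: T) i.
Proof.
rewrite (exchange_big_dep xpredT) //= [RHS](exchange_big_dep xpredT) //=.
apply: eq_bigr => i _.
rewrite (reindex_onto (fun T => i |: T) (fun S => S :\ i)) /=; last first.
  by move=> S; apply: setD1K.
apply: eq_bigl => T; rewrite setU11 /=; apply/eqP/idP => [<-|]; last exact: setU1K.
by rewrite !inE eqxx.
Qed.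

(** * Sweeping a cycle of the nerve *)

Section Sweep.
Variable h : {set 'I_n} -> int.
Hypothesis h_cycle : forall T, #|T| = m ->
  \sum_(i | (i \notin T) && basis_set (i |: T))
     h (i |: T) * sgz (dot (b i) (tau T)) = 0.

(** For two signs this is their half-sum: [e] times the indicator of the side
    [e]. *)
Definition step (e : int) (o : option bool) : int :=
  if e == sign_val o then e else 0.

(** [F] receives the value [h S], up to sign, from every vertex [S] such that
    [F] lies in the cone at that vertex, cut out by its hyperplanes, on which
    [l] is minimal at the apex. *)
Definition sweep l (F : covector n) : int :=
  \sum_(S | basis_set S) h S * \prod_(i in S) step (esign S l i) (F i).

(** When [l] lies in the span of [T], its expansion over a basis containing [T]
    does not depend on the remaining element. *)
Lemma esign_span T i j k l : i \notin T -> basis_set (i |: T) -> j \notin T ->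
  basis_set (j |: T) -> k \in T -> dot l (tau T) = 0 ->
  esign (i |: T) l k = esign (j |: T) l k.
Proof.
move=> iT bi jT bj kT lT.
have expand p : p \notin T -> basis_set (p |: T) ->
    exists2 c, l = \sum_(q in T) c q *: b q & esign (p |: T) l k = sgz (c k : R).
  move=> pT bp; have [c cE] := basis_expand l bp; exists c; last first.
    by rewrite {1}cE esign_coef // !inE kT orbT.
  have cp : c p = 0.
    have := dot_tau_coef B c (basis_card bp) (setU11 p T); rewrite -cE setU1K // lT.
    move/esym/eqP; rewrite mulf_eq0 => /orP[/eqP //|].
    by rewrite -[T](setU1K pT) (negPf (basis_tau bp (setU11 _ _))).
  by rewrite cE big_setU1 //= cp scale0r add0r.
have [c cE ->] := expand i iT bi; have [c' c'E ->] := expand j jT bj.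
have iT' : indep T := indep_sub (subsetUr [set i] T) (basis_indep bi).
have /iT'/(_ k kT)/eqP : \sum_(q in T) (c q - c' q) *: b q = 0.
  under eq_bigr do rewrite scalerBl.
  by rewrite sumrB -cE -c'E subrr.
by rewrite subr_eq0 => /eqP->.
Qed.

(** Where [l] lies in the span of [T], the cones at the vertices of the line of
    [T] are exchanged, along that line, with the opposite ones. The part of their
    contributions that comes from [T] is common to all of them, and what remains
    is the sum that vanishes for a cycle. The hypotheses say that [d] crosses
    these spans, and that each vertex sees at most one crossing at a time. *)
Lemma sweep_cross (F : covector n) l d : (forall i, F i != None) ->
  (forall S i, basis_set S -> i \in S -> dot l (tau (S :\ i)) = 0 ->
     dot d (tau (S :\ i)) != 0 /\
     forall k, k \in S -> k != i -> dot l (tau (S :\ k)) != 0) ->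
  exists2 e, 0 < e & forall a a', 0 < a <= e -> 0 < a' <= e ->
    sweep (l - a *: d) F = sweep (l + a' *: d) F.
Proof.
move=> fullF cross.
(* The sign of the slope of [l] along the line of [T] just after ([o = 1]) or
   just before ([o = -1]) the crossing. *)
pose lim (T : {set 'I_n}) (o : int) : int :=
  if dot l (tau T) == 0 then o * sgz (dot d (tau T)) else sgz (dot l (tau T)).
have limP d' o : (forall T, sgz (dot d' (tau T)) = o * sgz (dot d (tau T))) ->
  exists2 e, 0 < e & forall (T : {set 'I_n}) a, 0 < a <= e ->
    sgz (dot (l + a *: d') (tau T)) = lim T o.
  move=> dd'; apply: finite_small => T; rewrite /lim; have [l0|l0] := eqVneq.
    by exists 1 => // a /andP[a0 _]; rewrite dotDl dotZl l0 add0r sgzM gtr0_sgz // mul1r.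
  have [e e0 eE] := sgz_small (dot d' (tau T)) l0; exists e => // a /eE.
  by rewrite dotDl dotZl.
have [T|e e0 eP] := limP d 1; first by rewrite mul1r.
have [T|e' e'0 e'P] := limP (- d) (-1); first by rewrite dotNl sgzN mulN1r.
exists (Num.min e e') => [|a a']; first by rewrite lt_min e0.
rewrite !le_min => /and3P[a0 _ ae] /and3P[a'0 ae' _].
pose lsign S i o : int := lim (S :\ i) o * sgz (dot (b i) (tau (S :\ i))).
have -> : sweep (l - a *: d) F =
    \sum_(S | basis_set S) h S * \prod_(i in S) step (lsign S i (-1)) (F i).
  apply: eq_bigr => S _; congr (_ * _); apply: eq_bigr => i _; congr (step _ _).
  by rewrite /esign -scalerN e'P // a0.
have -> : sweep (l + a' *: d) F =
    \sum_(S | basis_set S) h S * \prod_(i in S) step (lsign S i 1) (F i).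
  apply: eq_bigr => S _; congr (_ * _); apply: eq_bigr => i _; congr (step _ _).
  by rewrite /esign eP // a'0.
apply/eqP; rewrite eq_sym -subr_eq0 -sumrB.
pose G S i := \prod_(k in S :\ i) step (esign S l k) (F k).
pose jump S i := if basis_set S && (dot l (tau (S :\ i)) == 0)
  then h S * sgz (dot d (tau (S :\ i))) * sgz (dot (b i) (tau (S :\ i))) * G S i
  else 0.
have lsignE S k o : dot l (tau (S :\ k)) != 0 -> lsign S k o = esign S l k.
  by rewrite /lsign /lim => /negPf->.
have -> : \sum_(S | basis_set S) (h S * \prod_(i in S) step (lsign S i 1) (F i) -
      h S * \prod_(i in S) step (lsign S i (-1)) (F i)) =
    \sum_(S : {set 'I_n}) \sum_(i in S) jump S i.
  rewrite big_mkcond /=; apply: eq_bigr => S _; rewrite /jump.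
  have [bS|_] := boolP (basis_set S); last by rewrite big1.
  have [i /andP[iS /eqP li]|none] := pickP (fun i => (i \in S) && (dot l (tau (S :\ i)) == 0)).
    have [di other] := cross S i bS iS li.
    rewrite [RHS](bigD1 i) //= li eqxx [X in _ = _ + X]big1 ?addr0; last first.
      by move=> k /andP[kS ki]; rewrite (negPf (other k kS ki)).
    have GE o : \prod_(k in S) step (lsign S k o) (F k) = step (lsign S i o) (F i) * G S i.
      rewrite (big_setD1 i) //=; congr (_ * _); apply: eq_bigr => k.
      by rewrite !inE => /andP[ki kS]; rewrite lsignE // other.
    rewrite !GE -mulrBr -mulrBl -!mulrA; congr (_ * _); rewrite mulrA; congr (_ * _).
    rewrite /lsign /lim li eqxx mul1r mulN1r mulNr /step.
    have := fullF i; have := basis_tau bS iS; move: di.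
    by do 2!case: sgzP => // _; case: (F i) => [[]|].
  rewrite [RHS]big1 => [|i iS]; last by have := none i; rewrite iS /= => ->.
  rewrite -mulrBr; apply/eqP; rewrite mulf_eq0 subr_eq0; apply/orP; right; apply/eqP.
  apply: eq_bigr => i iS; rewrite !lsignE //; first by have := none i; rewrite iS /= => ->.
  by have := none i; rewrite iS /= => ->.
rewrite sum_setD1 big1 // => T _.
have [lT|lT] := eqVneq (dot l (tau T)) 0; last first.
  by rewrite big1 // => i iT; rewrite /jump setU1K // (negPf lT) andbF.
have [i0 /andP[i0T b0]|none] := pickP (fun i => (i \notin T) && basis_set (i |: T)); last first.
  by rewrite big1 // => i iT; have := none i; rewrite /jump iT /= => ->.
have cT : #|T| = m by have := basis_card b0; rewrite cardsU1 i0T => -[].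
have -> : \sum_(i | i \notin T) jump (i |: T) i =
   (\sum_(i | (i \notin T) && basis_set (i |: T)) h (i |: T) * sgz (dot (b i) (tau T))) *
   (sgz (dot d (tau T)) * G (i0 |: T) i0); last by rewrite h_cycle // mul0r.
rewrite big_mkcondr mulr_suml /=; apply: eq_bigr => i iT; rewrite /jump setU1K // lT eqxx andbT.
case: ifP => [bi|]; last by rewrite mul0r.
have -> : G (i |: T) i = G (i0 |: T) i0.
  rewrite /G !setU1K //; apply: eq_bigr => k kT; congr (step _ _).
  exact: esign_span.
by rewrite -!mulrA; congr (_ * _); rewrite mulrCA.
Qed.

Lemma sweep_near (F : covector n) l d : generic l ->
  exists2 e, 0 < e & forall a, 0 < a <= e -> sweep (l + a *: d) F = sweep l F.
Proof.
move=> gl; have [T|e e0 eP] := @finite_small R {set 'I_n} (fun T a =>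
    dot l (tau T) != 0 -> sgz (dot (l + a *: d) (tau T)) = sgz (dot l (tau T))).
  have [->|lT] := eqVneq (dot l (tau T)) 0; first by exists 1.
  by have [e e0 eP] := sgz_small (dot d (tau T)) lT; exists e => // a /eP; rewrite dotDl dotZl.
exists e => // a ae; apply: eq_bigr => S bS; congr (_ * _); apply: eq_bigr => i iS.
by rewrite /esign eP // gl.
Qed.

(** The line from [l0] to [l1] never meets at the same point two of the
    hyperplanes spanned by the [m]-subsets of one basis. *)
Definition transverse l0 l1 := forall S i k, basis_set S -> i \in S -> k \in S ->
  k != i -> dot l1 (dot l0 (tau (S :\ i)) *: tau (S :\ k) -
                    dot l0 (tau (S :\ k)) *: tau (S :\ i)) != 0.

(** Along the line from [l0] to [l1] the sweep is constant away from the
    crossings, and takes the same value on both sides of each of them. *)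
Lemma sweep_indep (F : covector n) l0 l1 : (forall i, F i != None) ->
  generic l0 -> generic l1 -> transverse l0 l1 -> sweep l1 F = sweep l0 F.
Proof.
move=> fullF g0 g1 tr; pose d := l1 - l0; pose L (t : R) := l0 + t *: d.
have LD (t a : R) : L (t + a) = L t + a *: d by rewrite /L scalerDl addrA.
(* The value just to the right of [t], which also makes sense at a crossing. *)
pose P (t : R) := exists2 e, 0 < e & forall a, 0 < a <= e -> sweep (L (t + a)) F = sweep l0 F.
have PE (t : R) c : (exists2 e, 0 < e & forall a, 0 < a <= e -> sweep (L (t + a)) F = c) ->
    P t <-> c = sweep l0 F.
  move=> [e e0 eP]; split=> [[e' e'0 e'P]|cE]; last by exists e => // a; rewrite -cE; apply: eP.
  have m0 : 0 < Num.min e e' by rewrite lt_min e0.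
  by rewrite -(eP (Num.min e e')) ?m0 ?ge_min ?lexx // e'P // m0 ge_min lexx orbT.
have near (t : R) : generic (L t) -> P t <-> sweep (L t) F = sweep l0 F.
  by move=> gt; apply: PE; have [e e0 eP] := sweep_near F d gt; exists e => // a /eP; rewrite LD.
have L0 : L 0 = l0 by rewrite /L scale0r addr0.
have L1 : L 1 = l1 by rewrite /L scale1r addrC subrK.
suff /near : P 1 by rewrite L1; apply.
apply: (@locally_constant_pred _ P _ 0); last by apply/near; rewrite L0.
move=> r; have [S i bS iS ri|e e0 eP] := @sweep_cross F (L r) d fullF.
  have dE j : dot (L r) (tau (S :\ j)) =
      dot l0 (tau (S :\ j)) + r * dot d (tau (S :\ j)) by rewrite dotDl dotZl.
  have ddE j : dot d (tau (S :\ j)) = dot l1 (tau (S :\ j)) - dot l0 (tau (S :\ j)).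
    by rewrite dotDl dotNl.
  rewrite dE in ri; split=> [|k kS ki].
    by apply: contra_neq (g0 _ _ bS iS) => di; move: ri; rewrite di mulr0 addr0.
  apply: contraNneq (tr S i k bS iS kS ki) => rk; rewrite dE in rk.
  rewrite dotBr !dotZr; apply/eqP; move: (ddE i) (ddE k) => di dk.
  have -> : dot l1 (tau (S :\ k)) = dot d (tau (S :\ k)) + dot l0 (tau (S :\ k)) by lra.
  have -> : dot l1 (tau (S :\ i)) = dot d (tau (S :\ i)) + dot l0 (tau (S :\ i)) by lra.
  have -> : dot l0 (tau (S :\ i)) = - (r * dot d (tau (S :\ i))) by lra.
  have -> : dot l0 (tau (S :\ k)) = - (r * dot d (tau (S :\ k))) by lra.
  by ring.
exists e => // u; pose c := sweep (L r + e *: d) F.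
have pos a : 0 < a <= e -> sweep (L (r + a)) F = c.
  move=> ae; have ee : 0 < e <= e by rewrite e0 lexx.
  by rewrite LD -(eP a a ae ae) (eP a e ae ee).
have neg a : 0 < a <= e -> sweep (L (r - a)) F = c.
  by move=> ae; rewrite LD scaleNr; apply: eP => //; rewrite e0 lexx.
rewrite ltr_norml => /andP[ul ur]; rewrite (PE r c); last by exists e.
apply: PE; have [ru|ur'|ru] := ltrgtP r u; last by rewrite -ru; exists e.
  exists (r + e - u) => [|a /andP[a0 ae]]; first lra.
  have -> : u + a = r + (u + a - r) by ring.
  by apply: pos; apply/andP; split; lra.
exists ((r - u) / 2) => [|a /andP[a0 ae]]; first lra.
have -> : u + a = r - (r - u - a) by ring.
by apply: neg; apply/andP; split; lra.
Qed.

Lemma transverse_neq0 S i k l : generic l -> basis_set S -> i \in S -> k \in S ->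
  k != i -> dot l (tau (S :\ i)) *: tau (S :\ k) -
            dot l (tau (S :\ k)) *: tau (S :\ i) != 0.
Proof.
move=> gl bS iS kS ki; apply: contraTneq (gl _ _ bS kS) => w0.
have : dot (b i) 0 = 0 by rewrite dot0r.
rewrite -w0 dotBr !dotZr tau_mem ?(setD1_card (basis_card bS) kS) //; last first.
  by rewrite !inE eq_sym ki.
by move/eqP; rewrite mulr0 sub0r oppr_eq0 mulf_eq0 (negPf (basis_tau bS iS)) orbF negbK.
Qed.

(** If the cone at some vertex contained the unbounded cell [F] for every [l],
    then every [l] would be bounded below on [F]. Each coordinate and its
    opposite are sums of two covectors to which this applies. *)
Lemma sweep_unbounded (F : covector n) l0 : (forall i, F i != None) ->
  generic l0 -> ~ cell_bounded F -> sweep l0 F = 0.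
Proof.
move=> fullF g0 ubF.
pose good l := generic l /\ transverse l0 l.
suff [l [gl tl] lF] : exists2 l, good l & forall S, basis_set S ->
    exists2 i, i \in S & esign S l i != sign_val (F i).
  rewrite -(sweep_indep fullF g0 gl tl) /sweep big1 // => S bS.
  have [i iS /negPf si] := lF S bS.
  by rewrite (bigD1 i) //= /step si mul0r mulr0.
apply: contrapT => nol; apply: ubF.
have below l : good l -> exists K, forall x, F = cov x -> K <= dot l x.
  move=> gl; have [S bS SF] : exists2 S, basis_set S &
      forall i, i \in S -> esign S l i = sign_val (F i).
    apply: contrapT => noS; apply: nol; exists l => // S bS.
    apply: contrapT => noi; apply: noS; exists S => // i iS.
    by apply: contrapT => /eqP si; apply: noi; exists i.
  have [c cE] := basis_expand l bS; exists (- \sum_(i in S) c i * (psi i 0)%:~R) => x Fx.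
  rewrite cE dot_suml -sumrN; apply: ler_sum => i iS; rewrite dotZl.
  have := SF i iS; rewrite {1}cE esign_coef // Fx cov_val => cx.
  have : 0 <= c i * aff i x.
    have : 0 <= sgz (c i * aff i x) by rewrite sgzM cx -expr2 sqr_ge0.
    by rewrite sgz_ge0.
  by rewrite affE mulrDr -subr_ge0 opprK.
pose Tr := [seq dot l0 (tau (q.1.1 :\ q.1.2)) *: tau (q.1.1 :\ q.2) -
               dot l0 (tau (q.1.1 :\ q.2)) *: tau (q.1.1 :\ q.1.2) |
  q <- enum [pred q : ({set 'I_n} * 'I_n) * 'I_n |
    [&& basis_set q.1.1, q.1.2 \in q.1.1, q.2 \in q.1.1 & q.2 != q.1.2]]].
pose Ge := [seq tau (q.1 :\ q.2) |
  q <- enum [pred q : {set 'I_n} * 'I_n | basis_set q.1 && (q.2 \in q.1)]].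
have TrP S i k : basis_set S -> i \in S -> k \in S -> k != i ->
    dot l0 (tau (S :\ i)) *: tau (S :\ k) - dot l0 (tau (S :\ k)) *: tau (S :\ i)
      \in Tr.
  by move=> bS iS kS ki; apply/mapP; exists ((S, i), k); rewrite // mem_enum inE /= bS iS kS.
have GeP S i : basis_set S -> i \in S -> tau (S :\ i) \in Ge.
  by move=> bS iS; apply/mapP; exists (S, i); rewrite // mem_enum inE /= bS.
(* Both [l] and [u - l] have to avoid the same finite set of hyperplanes. *)
have split u : exists2 l, good l & good (u - l).
  have [w|l gl lP] := @generic_exists
      ([seq (w, 0) | w <- Tr] ++ [seq (w, dot u w) | w <- Tr ++ Ge]).
    have Tr0 w' : w' \in Tr -> w' != 0.
      case/mapP=> -[[S i] k]; rewrite mem_enum inE /= => /and4P[bS iS kS ki] ->.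
      exact: transverse_neq0.
    have Ge0 w' : w' \in Ge -> w' != 0.
      case/mapP=> -[S i]; rewrite mem_enum inE /= => /andP[bS iS] ->.
      by apply: contraTneq (basis_tau bS iS) => ->; rewrite dot0r eqxx.
    rewrite mem_cat => /orP[|] /mapP[w' + ->] /=; first exact: Tr0.
    by rewrite mem_cat => /orP[/Tr0|/Ge0].
  exists l; split=> //.
  - move=> S i k bS iS kS ki; apply: (lP (_, 0)); rewrite mem_cat; apply/orP; left.
    by apply/mapP; eexists; first exact: TrP bS iS kS ki.
  - move=> S i bS iS; rewrite dotDl dotNl subr_eq0 eq_sym.
    apply: (lP (_, dot u (tau (S :\ i)))); rewrite mem_cat; apply/orP; right.
    apply/mapP; exists (tau (S :\ i)) => //.
    by rewrite mem_cat (GeP _ _ bS iS) orbT.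
  - move=> S i k bS iS kS ki; rewrite dotDl dotNl subr_eq0 eq_sym.
    apply: (lP (_, dot u _)); rewrite mem_cat; apply/orP; right.
    by apply/mapP; eexists; last reflexivity; rewrite mem_cat (TrP _ _ _ bS iS kS ki).
have below_all u : exists K, forall x, F = cov x -> K <= dot u x.
  have [l gl gul] := split u; have [K KP] := below _ gl; have [K' K'P] := below _ gul.
  exists (K + K') => x Fx; rewrite -[u](subrK l) dotDl addrC.
  by rewrite lerD ?KP ?K'P.
have /choice[K KP] : forall j : 'I_m.+1, exists K, forall x, F = cov x -> `|x 0 j| <= K.
  move=> j; have [K KP] := below_all (delta_mx 0 j).
  have [K' K'P] := below_all (- delta_mx 0 j).
  exists (`|K| + `|K'|) => x Fx; have := KP x Fx; have := K'P x Fx.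
  rewrite dotNl !dot_delta => le1 le2; have := ler_norm (- K); have := ler_norm (- K').
  by rewrite !normrN ler_norml => le3 le4; apply/andP; split; have := normr_ge0 K; have := normr_ge0 K'; lra.
exists (\sum_j `|K j|) => x Fx j; apply: le_trans (KP j x Fx) _.
by rewrite (bigD1 j) //= (le_trans (ler_norm _)) // lerDl sumr_ge0.
Qed.

(** If the cone does not have its apex at [S], then some hyperplane through [S]
    does not bound it: crossing this hyperplane changes the sign but not the
    indicator of the cone. *)
Lemma mixed_difference l S S' : generic l -> basis_set S -> basis_set S' ->
  \sum_(F : covector n | [forall i, F i != None] && preceq (vtx S) F)
     (\prod_(i in S) sign_val (F i)) * \prod_(i in S') step (esign S' l i) (F i)
  = (S == S')%:R.
Proof.
move=> gl bS bS'; have [<-{S' bS'}|SS'] := eqVneq S S'; last first.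
  have [k kS kS'] : exists2 k, k \in S & k \notin S'.
    apply/subsetPn; apply: contra SS' => sub.
    by rewrite eqEcard sub (basis_card bS) (basis_card bS') leqnn.
  pose flip (F : covector n) : covector n :=
    [ffun i => if i == k then omap negb (F i) else F i].
  have flipE F i : flip F i = if i == k then omap negb (F i) else F i by rewrite ffunE.
  have flipK : involutive flip.
    by move=> F; apply/ffunP => i; rewrite !ffunE; case: (i == k); case: (F i) => [[]|].
  have flipI F : ([forall i, flip F i != None] && preceq (vtx S) (flip F)) =
      ([forall i, F i != None] && preceq (vtx S) F).
    congr (_ && _).
      by apply: eq_forallb => i; rewrite flipE; case: (i == k); case: (F i) => [[]|].
    apply: eq_forallb => i; rewrite flipE; have [->|//] := eqVneq i k.
    by rewrite -!zerosE zeros_vtx // kS.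
  set X := \sum_(F | _) _; suff : X = - X.
    by move/eqP; rewrite -subr_eq0 opprK -mulr2n mulrn_eq0 => /eqP.
  rewrite [LHS](reindex_inj (can_inj flipK)) /= -sumrN.
  apply: eq_big => [F|F _]; first exact: flipI.
  rewrite -mulNr; congr (_ * _); last first.
    by apply: eq_bigr => i iS'; rewrite flipE; have [ik|//] := eqVneq i k; rewrite -ik iS' in kS'.
  rewrite (bigD1 k) //= [in RHS](bigD1 k) //= -mulNr flipE eqxx; congr (_ * _).
    by case: (F k) => [[]|].
  by apply: eq_bigr => i /andP[_ /negPf ik]; rewrite flipE ik.
(* The only sign vector above the vertex [S] that lies in its cone. *)
pose E : covector n := [ffun i => if i \in S then Some (esign S l i == 1) else vtx S i].
have E0 i : E i = if i \in S then Some (esign S l i == 1) else vtx S i by rewrite ffunE.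
have esign1 i : i \in S -> esign S l i = 1 \/ esign S l i = -1.
  move=> iS; rewrite /esign; have := gl _ _ bS iS; have := basis_tau bS iS.
  by do 2!case: sgzP => //; rewrite ?mulr1 ?mulrN1 ?opprK; auto.
have EE i : i \in S -> sign_val (E i) = esign S l i.
  by move=> iS; rewrite E0 iS; case: (esign1 i iS) => ->.
rewrite (bigD1 E) /=; last first.
  apply/andP; split; apply/forallP => i; rewrite E0; case: ifP => iS //.
    by rewrite -zerosE zeros_vtx // iS.
  - by rewrite -zerosE zeros_vtx // iS.
  - by rewrite eqxx orbT.
rewrite [X in _ + X]big1 ?addr0 => [|F /andP[/andP[_ SF] /eqP FE]].
  rewrite -big_split big1 // => i iS /=; rewrite /step EE // eqxx.
  by case: (esign1 i iS) => ->.
have [i iS Fi] : exists2 i, i \in S & F i != E i.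
  apply/exists_inP; rewrite -negb_forall_in; apply/negP => /forall_inP FE'; case: FE.
  apply/ffunP => i; have [iS|iS] := boolP (i \in S); first exact/eqP/FE'.
  by rewrite E0 (negPf iS) (preceq_notin SF) // zeros_vtx.
rewrite [X in _ * X](bigD1 i) //= {1}/step -EE // (inj_eq sign_val_inj) eq_sym (negPf Fi).
by rewrite mul0r mulr0.
Qed.

End Sweep.
(** * Orientations and dimensions *)

Lemma det_rows_scale (c : 'I_n -> R) (L1 L2 : seq 'rV[R]_m.+1) (J : seq 'I_n) :
  (size L1 + size J <= m.+1)%N ->
  \det (rows_mx (L1 ++ [seq c j *: b j | j <- J] ++ L2)) =
  (\prod_(j <- J) c j) * \det (rows_mx (L1 ++ [seq b j | j <- J] ++ L2)).
Proof.
elim: J L1 => [|i J IH] L1 /=; first by rewrite big_nil mul1r.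
rewrite addnS => szJ.
have szL : (size L1 <= m)%N by rewrite -ltnS (leq_trans _ szJ) // ltnS leq_addr.
have scale L : \det (rows_mx (L1 ++ c i *: b i :: L)) =
    c i * \det (rows_mx (L1 ++ b i :: L)).
  rewrite !det_rows_mx_move // -!dot_cofactor_vec dotZl mulrCA; congr (_ * _).
have := IH (rcons L1 (b i)); rewrite !cat_rcons size_rcons addSn => /(_ szJ) IHi.
by rewrite scale IHi big_cons mulrA.
Qed.

Definition orient0 s (w : seq 'rV[R]_m.+1) : int :=
  sgz (\det (rows_mx ([seq b j | j <- enum (zeros s)] ++ w))).

Lemma orientE eps s w : (#|zeros s| <= m.+1)%N ->
  orient B eps s w = (\prod_(j in zeros s) sign_val (eps j)) * orient0 s w.
Proof.
move=> cs; rewrite /orient /orient0 -/(rows_mx _).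
have := @det_rows_scale (fun j => (sign_val (eps j))%:~R) [::] w (enum (zeros s)).
rewrite -cardE => /(_ cs) /= ->; rewrite sgzM; congr (_ * _).
rewrite -[RHS]big_enum; elim: (enum _) => [|j J IH]; first by rewrite !big_nil sgz1.
by rewrite !big_cons sgzM IH sgz_sign.
Qed.

Lemma orient_refE s w : (#|zeros s| <= m.+1)%N ->
  orient B (@ref_normals n) s w = orient0 s w.
Proof. by move=> cs; rewrite orientE // big1 // mul1r. Qed.

Lemma orient0_vertex s : orient0 s [::] = sgz (basis_det R B (zeros s)).
Proof. by rewrite /orient0 cats0. Qed.

Lemma cell_dimE s : indep (zeros s) -> cell_dim R B s = (m.+1 - #|zeros s|)%N.
Proof.
move=> /indep_row_free /eqP <-; rewrite /cell_dim /tangent mxrank_ker mxrank_tr.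
set M := \matrix_(i < n) _; congr (_ - _)%N.
apply/eqP; rewrite eqn_leq; apply/andP; split; apply: mxrankS.
  apply/row_subP => i; rewrite rowK; case: ifP => [iz|_]; last exact: sub0mx.
  rewrite -(enum_rankK_in iz iz) -(rowK (fun k => b (enum_val k))).
  exact: row_sub.
apply/row_subP => k; rewrite rowK; have := enum_valP k => kz.
have -> : b (enum_val k) = row (enum_val k) M by rewrite rowK kz.
exact: row_sub.
Qed.

Lemma cell_dim_realizable s : realizable s ->
  cell_dim R B s = (m.+1 - #|zeros s|)%N.
Proof. by move=> rs; apply/cell_dimE/indep_zeros. Qed.

Lemma zeros_card s : realizable s -> (#|zeros s| <= m.+1)%N.
Proof. by move=> /indep_zeros /indep_card. Qed.

Lemma regionE F : region R B psi F <->
  [/\ realizable F, cell_bounded F & forall i, F i != None].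
Proof.
rewrite /region bounded_cellE; split=> [[[rF bF]]|[rF bF fF]].
  rewrite (cell_dim_realizable rF) => dF; split=> // i; rewrite -zerosE.
  have /cards0_eq -> : #|zeros F| = 0%N.
    case: #|zeros F| dF => // k dF; have := leq_subr k m.
    by rewrite -subSS dF ltnn.
  by rewrite inE.
split=> //; rewrite (cell_dim_realizable rF) (_ : zeros F = set0) ?cards0 //.
by apply/setP => i; rewrite zerosE (negPf (fF i)) inE.
Qed.

Lemma vtx_bounded S : basis_set S -> bounded_cell R B psi (vtx S).
Proof.
move=> bS; apply/bounded_cellE; split; first exact: realizable_vtx.
exists (\sum_j `|vpt S 0 j|) => x xS j.
have -> : x = vpt S.
  apply: vpt_unique => // i iS; apply/eqP.
  by rewrite -cov_None -xS -zerosE zeros_vtx.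
by rewrite (bigD1 j) //= lerDl sumr_ge0.
Qed.

(** The common point of the hyperplanes of a basis is a bounded cell of dimension
    0, hence a point of [Gamma]. *)
Lemma nerve_simplex_basis S : #|S| = m.+1 ->
  nerve_simplex R B psi S <-> basis_set S.
Proof.
move=> cS; split=> [[x xS]|bS].
  apply/basisP; split=> //; apply: indep_sub (@simple x).
  apply/subsetP => i iS; rewrite zerosE cov_None; apply/eqP.
  by have [] := xS i iS.
exists (vpt S) => i iS; split; last exact: vptP.
split.
  exists (vtx S); first exact: vtx_bounded.
  exact/cellE.
case=> F /regionE[_ _ fF] /cellE FE.
by have := fF i; rewrite FE -zerosE zeros_vtx ?(negPf iS) //= iS.
Qed.

Lemma nerve_simplex_card S : nerve_simplex R B psi S -> (#|S| <= m.+1)%N.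
Proof.
case=> x xS; apply: leq_trans (indep_card (@simple x)); apply/subset_leq_card.
apply/subsetP => i iS; rewrite zerosE cov_None; apply/eqP.
by have [] := xS i iS.
Qed.

(** * Cycles of the nerve *)

Local Notation Nerve := (nerve_complex R B psi).

(** Freed from the orientation of the simplex, the coefficient at a vertex is the
    quantity that mixed differences produce. *)
Definition det_coef (g : chain Nerve) S : int :=
  sgz (basis_det R B S) * (g : {ffun {set 'I_n} -> int}) S.

Lemma nerve_kchainsP (g : chain Nerve) :
  reflect (forall S, g S != 0 -> basis_set S) (g \in kchains m).
Proof.
apply: (iffP forallP) => gP S.
  move=> gS; have /implyP/(_ gS)/andP[/asboolP nS /eqP cS] := gP S.
  exact/(nerve_simplex_basis cS).
apply/implyP => /gP bS; have cS := basis_card bS.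
by rewrite /= cS eqxx andbT; apply/asboolP/nerve_simplex_basis.
Qed.

Lemma sum_nerve_bdry (g : chain Nerve) T : (forall S, g S != 0 -> basis_set S) ->
  \sum_S g S * (\sum_(i in S | T == S :\ i) (-1) ^+ #|[set j in S | (j < i)%N]|) =
  if #|T| == m then
    \sum_(i | (i \notin T) && basis_set (i |: T))
      det_coef g (i |: T) * sgz (dot (b i) (tau T))
  else 0.
Proof.
move=> gb; pose f S i := if T == S :\ i
  then g S * (-1) ^+ #|[set j in S | (j < i)%N]| else 0.
have -> : \sum_S g S * (\sum_(i in S | T == S :\ i) (-1) ^+ #|[set j in S | (j < i)%N]|) =
    \sum_(S : {set 'I_n}) \sum_(i in S) f S i.
  by apply: eq_bigr => S _; rewrite mulr_sumr big_mkcondr.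
rewrite sum_setD1 (bigD1 T) //= [X in _ + X]big1 ?addr0; last first.
  by move=> T' nT; apply: big1 => i iT; rewrite /f setU1K // eq_sym (negPf nT).
case: eqP => cT; last first.
  apply: big1 => i iT; rewrite /f setU1K // eqxx.
  have [->|/gb bi] := eqVneq (g (i |: T)) 0; first by rewrite mul0r.
  by case: cT; have := basis_card bi; rewrite cardsU1 iT => -[].
rewrite [RHS]big_mkcondr; apply: eq_bigr => i iT; rewrite /f setU1K // eqxx.
case: ifPn => [bi|nb]; last first.
  by have [->|/gb bi] := eqVneq (g (i |: T)) 0; [rewrite mul0r | rewrite bi in nb].
rewrite /det_coef (basis_det_tau R B (basis_card bi) (setU11 i T)) setU1K // sgzM.
have ti : dot (b i) (tau T) != 0 by rewrite -[T in tau T](setU1K iT) basis_tau ?setU11.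
rewrite -!mulrA [X in _ = _ * X]mulrC -!mulrA sgz_sqr // mulr1 mulrC; congr (_ * _).
by elim: #|_| => [|k IH]; rewrite ?expr0 ?sgz1 // !exprS sgzM -IH sgzN1.
Qed.

(** In degree 0 the augmentation is the condition at the empty set, which the
    boundary omits. *)
Lemma nerve_cyclesP (g : chain Nerve) :
  reflect ((forall S, g S != 0 -> basis_set S) /\
     forall T, #|T| = m ->
     \sum_(i | (i \notin T) && basis_set (i |: T))
       det_coef g (i |: T) * sgz (dot (b i) (tau T)) = 0)
    (g \in cycles Nerve m).
Proof.
have aug0 : (forall S, g S != 0 -> basis_set S) -> m = 0%N ->
    \sum_S g S * aug (b := Nerve) S =
    \sum_S g S * (\sum_(i in S | set0 == S :\ i) (-1) ^+ #|[set j in S | (j < i)%N]|).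
  move=> gb m0; apply: eq_bigr => S _; have [->|/gb bS] := eqVneq (g S) 0.
    by rewrite !mul0r.
  have /eqP/cards1P[i Si] : #|S| = 1%N by rewrite (basis_card bS) m0.
  congr (_ * _); rewrite (bigD1 i) /=; last by rewrite Si inE eqxx setDv eqxx.
  rewrite big1 ?addr0 => [|k /andP[/andP[]]]; last by rewrite Si inE => ->.
  rewrite (_ : [set _ in _ | _] = set0) ?cards0 //.
  by apply/setP => j; rewrite !inE Si inE; case: eqP => // ->; rewrite ltnn.
apply: (iffP and3P) => [[/nerve_kchainsP gb /eqP db /implyP ag]|[gb gT]].
  split=> // T cT; have := sum_nerve_bdry T gb; rewrite cT eqxx => <-.
  have [T0|T0] := eqVneq T set0; last first.
    have := congr1 (fun c : chain Nerve => c T) db; rewrite !ffunE; apply: etrans.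
        by apply: eq_bigr => S _; rewrite /= /simplex_inc (negPf T0).
  have m0 : m = 0%N by rewrite -cT T0 cards0.
  by rewrite T0 -aug0 //; apply/eqP/ag; rewrite m0.
split; first exact/nerve_kchainsP.
  apply/eqP/ffunP => T; rewrite !ffunE.
  have [->|T0] := eqVneq T set0.
    by apply: big1 => S _; rewrite /= /simplex_inc eqxx mulr0.
  transitivity (\sum_S g S * (\sum_(i in S | T == S :\ i) (-1 : int) ^+ #|[set j in S | (j < i)%N]|)).
        by apply: eq_bigr => S _; rewrite /= /simplex_inc (negPf T0).
  by rewrite sum_nerve_bdry //; case: eqP => // /gT.
apply/implyP => /eqP m0; rewrite aug0 // sum_nerve_bdry //.
by apply/eqP; case: eqP => // /gT.
Qed.
Lemma vertex_faceE v F : realizable F ->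
  `[< face R B psi v F >] && (cell_dim R B v == 0%N) =
  [&& basis_set (zeros v), preceq v F & v == vtx (zeros v)].
Proof.
move=> rF; apply/andP/and3P => [[/asboolP/(faceE _ rF)[rv vF] dv]|[bv vF /eqP vE]].
  have [|bv vE] := vtx_zeros rv; first by rewrite -subn_eq0 -cell_dim_realizable.
  by split=> //; apply/eqP.
have rv : realizable v by rewrite vE; apply: realizable_vtx.
rewrite (cell_dim_realizable rv) (basis_card bv) subnn; split=> //.
by apply/asboolP/(faceE _ rF).
Qed.

Lemma Psi_chainE F S : realizable F -> Psi_chain R B psi F S =
  if basis_set S && preceq (vtx S) F
  then sgz (basis_det R B S) * \prod_(i in S) sign_val (F i) else 0.
Proof.
move=> rF; rewrite ffunE; case: ifPn => [/andP[bS SF]|nS]; last first.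
  apply: big1 => v; rewrite vertex_faceE // => /and3P[bv vF /eqP vE].
  have [SE|_] := eqVneq S (zeros v); last by rewrite mulr0.
  by rewrite SE bv -vE vF in nS.
rewrite (bigD1 (vtx S)) /=; last by rewrite vertex_faceE // zeros_vtx // bS SF /=.
rewrite big1 ?addr0 => [|v /andP[]]; last first.
  rewrite vertex_faceE // => /and3P[bv vF /eqP vE] vS.
  case: eqP => [SE|_]; last by rewrite mulr0.
  by rewrite SE -vE eqxx in vS.
rewrite zeros_vtx // eqxx mulr1 orientE ?zeros_card ?realizable_vtx //; last exact: realizable_vtx.
by rewrite orient0_vertex zeros_vtx // mulrC.
Qed.

Lemma det_coef_id (g : chain Nerve) S : basis_set S ->
  sgz (basis_det R B S) * det_coef g S = (g : {ffun {set 'I_n} -> int}) S.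
Proof.
by move=> bS; rewrite /det_coef mulrA sgz_sqr ?mul1r // basis_det_neq0.
Qed.

(** The coefficients are the values of the sweep for a generic form: they vanish
    off the bounded regions, and their mixed differences are those of [g]. *)
Lemma nerve_cycles_span (g : chain Nerve) : g \in cycles Nerve m ->
  exists2 f : covector n -> int, forall F, f F != 0 -> region R B psi F &
    forall S, (g : {ffun {set 'I_n} -> int}) S = \sum_F f F * Psi_chain R B psi F S.
Proof.
move=> /nerve_cyclesP[gb gT].
have [l gl _] := @generic_exists [::] (fun _ => ltac:(by [])).
pose f F : int := if `[< region R B psi F >] then sweep (det_coef g) l F else 0.
have fR F : f F != 0 -> region R B psi F.
  by rewrite /f; case: asboolP => //; rewrite eqxx.
exists f => // S.
have [bS|nS] := boolP (basis_set S); last first.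
  rewrite (_ : g S = 0); last by apply: contraNeq nS; apply: gb.
  rewrite big1 // => F _; have [->|/fR/regionE[rF _ _]] := eqVneq (f F) 0; first by rewrite mul0r.
  by rewrite Psi_chainE // (negPf nS) mulr0.
transitivity (sgz (basis_det R B S) * \sum_(F : covector n |
    [forall i, F i != None] && preceq (vtx S) F)
    sweep (det_coef g) l F * \prod_(i in S) sign_val (F i)); last first.
  rewrite mulr_sumr big_mkcond /=; apply: eq_bigr => F _.
  case: ifPn => [/andP[/forallP fF SF]|nF].
    have rF : realizable F := realizable_up (realizable_vtx S) SF.
    rewrite Psi_chainE // bS SF /= mulrCA; congr (_ * _); rewrite /f.
    have unb : ~ cell_bounded F -> sweep (det_coef g) l F = 0.
      exact: sweep_unbounded.
    case: asboolP => // nR; rewrite unb // => bF.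
    by apply: nR; apply/regionE.
  have [->|/fR/regionE[rF _ fF]] := eqVneq (f F) 0; first by rewrite mul0r.
  rewrite Psi_chainE //; case: ifP => [/andP[_ SF]|]; last by rewrite mulr0.
  by case/negP: nF; rewrite SF andbT; apply/forallP.
rewrite -[LHS](det_coef_id _ bS); congr (_ * _).
under [RHS]eq_bigr do rewrite /sweep mulr_suml.
rewrite exchange_big /= (bigD1 S) //= [X in _ + X]big1 ?addr0 => [|S' /andP[bS' S'S]].
  transitivity (det_coef g S * (S == S)%:R); first by rewrite eqxx mulr1.
  rewrite -(mixed_difference gl bS bS) mulr_sumr.
  by apply: eq_bigr => F _; rewrite -mulrA; congr (_ * _); rewrite mulrC.
transitivity (det_coef g S' * (S == S')%:R); last by rewrite eq_sym (negPf S'S) mulr0.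
rewrite -(mixed_difference gl bS bS') mulr_sumr.
by apply: eq_bigr => F _; rewrite -mulrA; congr (_ * _); rewrite mulrC.
Qed.
(** * Cycles of [Gamma] *)

Local Notation Gam := (Gamma_complex R B psi).

Lemma tangent_orth s j (w : 'rV[R]_m.+1) : j \in zeros s ->
  (w <= tangent R B s)%MS -> dot (b j) w = 0.
Proof.
move=> jz /sub_kermxP w0; rewrite dotC dotE.
have -> : b j = row j (\matrix_(i < n) (if i \in zeros s then b i else 0)).
  by rewrite rowK jz.
by rewrite tr_row colE mulmxA w0 mul0mx mxE.
Qed.

Lemma tangent_basis_sub s w : w \in tangent_basis R B s -> (w <= tangent R B s)%MS.
Proof.
by case/mapP=> l _ ->; rewrite (submx_trans (row_sub _ _)) // eq_row_base.
Qed.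

Lemma size_tangent_basis s : size (tangent_basis R B s) = cell_dim R B s.
Proof. by rewrite size_map size_enum_ord. Qed.

(** A vector orthogonal to all the rows is tangent to the cell and orthogonal
    to its tangent space. *)
Lemma orient0_neq0 s : indep (zeros s) -> orient0 s (tangent_basis R B s) != 0.
Proof.
move=> is_; rewrite sgz_eq0 -det_tr -unitfE -unitmxE -row_free_unit -kermx_eq0.
have cz : (#|zeros s| <= m.+1)%N := indep_card is_.
set L := _ ++ _; have szL : size L = m.+1.
  by rewrite size_cat size_map -cardE size_tangent_basis cell_dimE // subnKC.
apply/rowV0P => y /sub_kermxP y0.
have yL w : w \in L -> dot y w = 0.
  move=> wL; have ltw : (index w L < m.+1)%N by move: wL; rewrite -index_mem szL.
  have := congr1 (fun v : 'rV_m.+1 => v 0 (Ordinal ltw)) y0.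
  rewrite !mxE => <-; apply: eq_bigr => j _.
  by rewrite !mxE nth_index.
have yt : (y <= tangent R B s)%MS.
  apply/sub_kermxP/rowP => i; rewrite !mxE.
  transitivity (dot y (if i \in zeros s then b i else 0)).
    by apply: eq_bigr => j _; rewrite !mxE.
  case: ifP => iz; last by rewrite dot0r.
  by apply: yL; rewrite mem_cat map_f ?mem_enum.
apply/eqP; rewrite -dot_eq0; move: yt; rewrite -(eq_row_base (tangent R B s)).
case/submxP => u {1}->; rewrite mulmx_sum_row dot_suml big1 // => k _.
rewrite dotZl dotC yL ?mulr0 // mem_cat; apply/orP; right.
by apply/mapP; exists k; rewrite ?mem_enum.
Qed.

Lemma orient_coefE eps s : indep (zeros s) ->
  orient_coef R B eps s = \prod_(j in zeros s) sign_val (eps j).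
Proof.
move=> is_; have cz := indep_card is_.
rewrite /orient_coef orient_refE // orientE // -mulrA.
have := orient0_neq0 is_; rewrite sgz_eq0 => o0.
by rewrite /orient0 sgz_sqr // mulr1.
Qed.

(** Expanding [x] over the rows [b i], [b k] and [L], the determinant on the
    left is the one on the right times the coefficient of [b k]; pairing [x]
    with the part of [b k] orthogonal to [b i] gives the sign of that
    coefficient. *)
Lemma sgz_det_exchange i k x (L : seq 'rV[R]_m.+1) : size L = m.-1 ->
  (forall w, w \in L -> dot (b i) w = 0 /\ dot (b k) w = 0) ->
  dot (b i) x = 0 -> i != k -> indep [set i; k] ->
  \det (rows_mx (b i :: b k :: L)) != 0 ->
  sgz (\det (rows_mx (b i :: x :: L))) =
  sgz (dot (b k) x) * sgz (\det (rows_mx (b i :: b k :: L))).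
Proof.
move=> szL orthL bix ik indik D0.
have m_gt0 : (0 < m)%N.
  rewrite -ltnS; apply: leq_trans (indep_card indik).
  by rewrite cards2 ik.
have swap y : \det (rows_mx (b i :: y :: L)) = - dot y (cofactor_vec (b i :: L)).
  by rewrite -[_ :: _]cat1s (det_rows_mx_move (L1 := [:: b i])) // expr1 mulN1r dot_cofactor_vec.
have cofL w : w \in b i :: L -> dot w (cofactor_vec (b i :: L)) = 0.
  by move=> wL; apply: dot_cofactor_vec_mem wL _; rewrite /= szL prednK.
have [a [a' [z [xE zi zk zc]]]] : exists a a' z,
    [/\ x = a *: b i + a' *: b k + z, dot (b i) z = 0, dot (b k) z = 0
      & dot z (cofactor_vec (b i :: L)) = 0].
  have uN : rows_mx (b i :: b k :: L) \in unitmx by rewrite unitmxE unitfE.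
  pose u := x *m invmx (rows_mx (b i :: b k :: L)).
  have xu : x = u *m rows_mx (b i :: b k :: L) by rewrite mulmxKV.
  pose o0 : 'I_m.+1 := inord 0; pose o1 : 'I_m.+1 := inord 1.
  have v0 : o0 = 0 :> nat by rewrite inordK.
  have v1 : o1 = 1%N :> nat by rewrite inordK.
  have o10 : o1 != o0 by rewrite -val_eqE /= v0 v1.
  exists (u 0 o0), (u 0 o1), (\sum_(l | (l != o0) && (l != o1)) u 0 l *: nth 0 (b i :: b k :: L) l).
  have memL (l : 'I_m.+1) : (l != o0) && (l != o1) -> nth 0 (b i :: b k :: L) l \in L.
    case/andP; rewrite -!val_eqE /= v0 v1; case: l => [[|[|l]]] //= ltl _ _.
    by rewrite mem_nth // szL; case: m ltl => // ?; rewrite ltnS.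
  split.
  - rewrite {1}xu mulmx_sum_row (bigD1 o0) // (bigD1 o1) //= !rowK v0 v1 /= addrA.
    by congr (_ + _); apply: eq_bigr => l _; rewrite rowK.
  - rewrite dotC dot_suml big1 // => l /memL lL.
    by rewrite dotZl dotC (orthL _ lL).1 mulr0.
  - rewrite dotC dot_suml big1 // => l /memL lL.
    by rewrite dotZl dotC (orthL _ lL).2 mulr0.
  - rewrite dot_suml big1 // => l /memL lL.
    by rewrite dotZl cofL ?mulr0 // inE lL orbT.
have xc : dot x (cofactor_vec (b i :: L)) = a' * dot (b k) (cofactor_vec (b i :: L)).
  by rewrite xE !dotDl !dotZl zc (cofL _ (mem_head _ _)) mulr0 add0r addr0.
rewrite !swap xc -mulrN sgzM; congr (_ * _).
pose q := dot (b i) (b i) *: b k - dot (b i) (b k) *: b i.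
have bi0 : dot (b i) (b i) != 0.
  rewrite dot_eq0; apply/eqP => bi.
  have sum0 : \sum_(j in [set i; k]) (j == i)%:R *: b j = 0.
    rewrite big_setU1 ?inE //= big_set1 eqxx bi scaler0.
    by rewrite eq_sym (negPf ik) scale0r addr0.
  have := indik _ sum0 i (setU11 _ _).
  by rewrite eqxx => /eqP; rewrite oner_eq0.
have q0 : q != 0.
  apply/eqP => qE.
  pose c j := if j == k then dot (b i) (b i) else - dot (b i) (b k).
  have sum0 : \sum_(j in [set i; k]) c j *: b j = 0.
    by rewrite big_setU1 ?inE //= big_set1 /c eqxx (negPf ik) scaleNr addrC -/q.
  have := indik _ sum0 k (setU1r _ (set11 _)).
  by rewrite /c eqxx => /eqP; rewrite (negPf bi0).
have bi_gt0 : 0 < dot (b i) (b i) by apply: dot_gt0; rewrite -dot_eq0.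
have qx : dot (b i) (b i) * dot (b k) x * dot (b i) (b i) = a' * dot q q.
  have bkx : dot (b k) x = a * dot (b i) (b k) + a' * dot (b k) (b k).
    by rewrite xE !dotDr !dotZr zk addr0 (dotC (b k) (b i)).
  have bix' : a * dot (b i) (b i) + a' * dot (b i) (b k) = 0.
    by rewrite -bix xE !dotDr !dotZr zi addr0.
  rewrite bkx /q !(dotBr, dotNl, dotDl, dotZl, dotZr) (dotC (b k) (b i)).
  move: bix'; move: (dot (b i) (b i)) (dot (b i) (b k)) (dot (b k) (b k)) => p r t E.
  apply/eqP; rewrite -subr_eq0; apply/eqP.
  by transitivity (p * r * (a * p + a' * r)); [ring | rewrite E mulr0].
have := congr1 (fun r : R => sgz r) qx; rewrite !sgzM.
by rewrite (gtr0_sgz bi_gt0) (gtr0_sgz (dot_gt0 q0)) mul1r !mulr1.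
Qed.
Lemma enum_set2 (i k : 'I_n) : (i < k)%N -> enum [set i; k] = [:: i; k].
Proof.
move=> ik; have nik : i != k by rewrite -val_eqE /= ltn_eqF.
have [L1 [L2 [eS eSi cE]]] := enum_split (setU11 i [set k]).
have e1 : enum ([set i; k] :\ i) = [:: k].
  by rewrite setU1K ?inE // enum_set1.
have L10 : L1 = [::].
  apply/eqP; rewrite -size_eq0 -cE cards_eq0; apply/eqP/setP => j.
  rewrite !inE; apply/negbTE; apply/negP => /andP[/orP[]/eqP->]; rewrite ?ltnn //.
  by rewrite ltnNge ltnW.
by move: eS eSi; rewrite L10 /= e1 => -> <-.
Qed.

(** The outward vector leads from the side of [s] on the [k]-th hyperplane to that
    hyperplane, whence the minus sign; if [k < i] the normals of [t] come in the
    other order. *)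
Lemma cell_incE s t i k : realizable s -> realizable t -> preceq t s ->
  i != k -> zeros s = [set i] -> zeros t = [set i; k] ->
  cell_inc R B psi s t = (if (i < k)%N then -1 else 1) * sign_val (s k).
Proof.
move=> rs rt ts ik zs zt; have [y yt] := rt; have [x xs] := rs.
have it := indep_zeros rt; have is_ := indep_zeros rs.
have ct : (#|zeros t| <= m.+1)%N by apply: zeros_card.
have c2 : #|zeros t| = 2%N by rewrite zt cards2 ik.
have dims : cell_dim R B s == (cell_dim R B t).+1.
  rewrite !cell_dim_realizable // c2 zs cards1 subn1 /= subSS subn1 prednK //.
  by rewrite -ltnS -c2.
rewrite /cell_inc dims andbT.
have -> : `[< face R B psi t s >] by apply/asboolP/(faceE _ rs).
have ws : cov (xget 0 (cell B psi s)) = s.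
  by case: xgetP => [p _ /cellE <- //|/(_ x)]; case; apply/cellE.
have wt : cov (xget 0 (cell B psi t)) = t.
  by case: xgetP => [p _ /cellE <- //|/(_ y)]; case; apply/cellE.
set p := xget 0 (cell B psi t) in wt *; set q := xget 0 (cell B psi s) in ws *.
have dE j : dot (b j) (p - q) = aff j p - aff j q by rewrite dotBr !affE; lra.
have p0 j : j \in zeros t -> aff j p = 0.
  by rewrite -wt zerosE cov_None => /eqP.
have q0 : aff i q = 0.
  by apply/eqP; rewrite -cov_None ws -zerosE zs inE.
have bi : dot (b i) (p - q) = 0 by rewrite dE p0 ?q0 ?subrr // zt !inE eqxx.
have bk : sgz (dot (b k) (p - q)) = - sign_val (s k).
  by rewrite dE p0 ?sub0r ?zt ?inE ?eqxx ?orbT // sgzN -cov_val ws.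
set w := tangent_basis R B t.
have szw : size w = m.-1.
  by rewrite size_tangent_basis cell_dim_realizable // c2 subSS subn1.
have ow z : z \in w -> dot (b i) z = 0 /\ dot (b k) z = 0.
  move=> /tangent_basis_sub vt.
  by split; apply: tangent_orth vt; rewrite zt !inE eqxx ?orbT.
rewrite !orient_refE //; last by rewrite zs cards1.
have := orient0_neq0 it; rewrite -/w /orient0 zs enum_set1 /=.
have det_swap j j' : \det (rows_mx (b j :: b j' :: w)) = - \det (rows_mx (b j' :: b j :: w)).
  have m_gt0 : (0 < m)%N by rewrite -ltnS -c2.
  by rewrite -[b j :: _]cat1s (det_rows_mx_move (L1 := [:: b j])) // expr1 mulN1r.
have main : \det (rows_mx (b i :: b k :: w)) != 0 ->
    sgz (\det (rows_mx (b i :: p - q :: w))) * sgz (\det (rows_mx (b i :: b k :: w))) =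
    - sign_val (s k).
  move=> D0; rewrite (@sgz_det_exchange i k (p - q) w) //; last by rewrite -zt.
  by rewrite bk -mulrA sgz_sqr // mulr1.
have [lt|lt|/eqP] := ltngtP i k; last by rewrite val_eqE (negPf ik).
  by rewrite zt enum_set2 // sgz_eq0 /= => /main ->; rewrite mulN1r.
rewrite zt setUC enum_set2 //= sgz_eq0 det_swap oppr_eq0 => /main E.
by rewrite sgzN mulrN E opprK mul1r.
Qed.

Lemma gamma_kchainsP (c : chain Gam) :
  reflect (forall s, c s != 0 -> [/\ realizable s, cell_bounded s & #|zeros s| = 1%N])
    (c \in kchains m).
Proof.
apply: (iffP forallP) => cP s.
  move=> cs; have /implyP/(_ cs)/asboolP[/bounded_cellE[rs bs] _] := cP s.
  rewrite (cell_dim_realizable rs) => dm; split=> //.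
  by rewrite -(subKn (zeros_card rs)) dm subSnn.
apply/implyP => /cP[rs bs z1]; apply/asboolP; split.
- exact/bounded_cellE.
- case/regionE=> _ _ fs; move/eqP: z1 => /cards1P[i zi].
  by have := fs i; rewrite -zerosE zi inE eqxx.
- by rewrite cell_dim_realizable // z1 subn1.
Qed.

Definition facets (c : chain Gam) :=
  forall s, c s != 0 -> [/\ realizable s, cell_bounded s & #|zeros s| = 1%N].

Lemma gamma_bdryE (c : chain Gam) t (i k : 'I_n) : facets c -> realizable t ->
  (i < k)%N -> zeros t = [set i; k] ->
  bdry c t = \sum_(s | preceq t s && (zeros s == [set k])) sign_val (s i) * c s -
             \sum_(s | preceq t s && (zeros s == [set i])) sign_val (s k) * c s.
Proof.
move=> fc rt lt zt; have ik : i != k by rewrite -val_eqE /= ltn_eqF.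
rewrite ffunE [X in _ = X - _]big_mkcond [X in _ = _ - X]big_mkcond /= -sumrB.
apply: eq_bigr => s _; have [->|/fc[rs bs z1]] := eqVneq (c s) 0.
  by rewrite !mulr0 mul0r !if_same subrr.
have [ts|nts] /= := boolP (preceq t s); last first.
  rewrite subrr /cell_inc; case: asboolP => [/(faceE _ rs)[_ ts]|_]; last by rewrite mulr0.
  by rewrite ts in nts.
move/eqP: z1 => /cards1P[j zj].
have : j \in zeros t by apply: (subsetP (preceq_zeros ts)); rewrite zj inE.
rewrite zt !inE zj => /orP[] /eqP ji; rewrite {}ji in zj *.
  rewrite (@cell_incE s t i k) // lt (inj_eq set1_inj) (negPf ik) eqxx sub0r.
  by rewrite mulN1r mulrN mulrC.
rewrite (@cell_incE s t k i) ?[k == i]eq_sym // 1?setUC // ltnNge ltnW //= eqxx.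
by rewrite (inj_eq set1_inj) eq_sym (negPf ik) subr0 mul1r mulrC.
Qed.

Lemma gamma_bdry0 (c : chain Gam) t : facets c ->
  ~ (realizable t /\ #|zeros t| = 2%N) -> bdry c t = 0.
Proof.
move=> fc nt; rewrite ffunE big1 // => s _.
have [->|/fc[rs bs z1]] := eqVneq (c s) 0; first by rewrite mul0r.
rewrite /= /cell_inc; case: ifPn; last by rewrite mulr0.
case/andP=> /asboolP/(faceE _ rs)[rt ts]; rewrite !cell_dim_realizable // z1 subn1 /=.
move=> /eqP dm; case: nt; split=> //.
move: (zeros_card rt) dm; move: #|zeros t| => z zle dm; apply/eqP.
by rewrite -(eqn_add2l (m.+1 - z)) subnK // addn2 -dm.
Qed.

Definition mask s T : covector n := [ffun j => if j \in T then None else s j].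

Lemma maskE s T j : mask s T j = if j \in T then None else s j.
Proof. by rewrite ffunE. Qed.

Lemma mask_preceq s T : preceq (mask s T) s.
Proof. by apply/preceqP => j; rewrite maskE; case: ifP; [left|right]. Qed.

Lemma zeros_mask s T : zeros (mask s T) = zeros s :|: T.
Proof. by apply/setP => j; rewrite !inE maskE; case: (j \in T); rewrite ?orbT ?orbF. Qed.

Lemma preceq_mask t s T : preceq t s -> T \subset zeros t -> preceq t (mask s T).
Proof.
move=> /preceqP ts /subsetP Tt; apply/preceqP => j; rewrite maskE; case: ifP => // /Tt.
by rewrite zerosE => /eqP; left.
Qed.

Lemma mask_eq t s T : preceq t s -> zeros t = zeros s :|: T -> mask s T = t.
Proof.
move=> ts zt; apply/esym/preceq_eq; last by rewrite zeros_mask zt.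
by apply: preceq_mask => //; rewrite zt subsetUr.
Qed.

(** The mixed difference at the vertex [S], along the hyperplanes other than
    the [i]-th one, of the restriction of [c] to that hyperplane. *)
Definition flux (c : chain Gam) S i : int :=
  \sum_(s | preceq (vtx S) s && (zeros s == [set i]))
    (\prod_(j in S :\ i) sign_val (s j)) * c s.

Lemma flux_split (c : chain Gam) S i k : basis_set S -> i \in S -> k \in S -> k != i ->
  flux c S i =
  \sum_(t | preceq (vtx S) t && (zeros t == [set i; k]))
    (\prod_(j in S :\ i :\ k) sign_val (t j)) *
    \sum_(s | preceq t s && (zeros s == [set i])) sign_val (s k) * c s.
Proof.
move=> bS iS kS ki.
rewrite /flux (partition_big (fun s => mask s [set k])
  (fun t => preceq (vtx S) t && (zeros t == [set i; k]))) /=; last first.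
  move=> s /andP[Ss /eqP zs]; rewrite zeros_mask zs eqxx andbT.
  by apply: preceq_mask; rewrite // sub1set zeros_vtx.
apply: eq_bigr => t /andP[St /eqP zt]; rewrite mulr_sumr.
apply: eq_big => [s|s /andP[/andP[Ss /eqP zs] /eqP mt]]; last first.
  rewrite (big_setD1 k) /=; last by rewrite !inE ki.
  rewrite -mulrA mulrCA; congr (_ * _); apply: eq_bigr => j.
  rewrite !inE => /andP[jk _]; by rewrite -mt maskE inE (negPf jk).
have [zs|_] := eqVneq (zeros s) [set i]; rewrite ?andbF ?andbT //.
apply/andP/idP => [[Ss /eqP <-]|ts]; first exact: mask_preceq.
by rewrite (preceq_trans St ts); split=> //; apply/eqP/mask_eq; rewrite // zs zt.
Qed.

(** The boundaries of [c] at the cells of codimension two on both hyperplanes,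
    added with the signs that they have around the vertex, are the difference of
    the two fluxes. *)
Lemma flux_indep (c : chain Gam) S (i k : 'I_n) : facets c -> bdry c = 0 ->
  basis_set S -> i \in S -> k \in S -> flux c S i = flux c S k.
Proof.
move=> fc dc bS; wlog lt : i k / (i < k)%N => [hw|] iS kS.
  have [lt|lt|/val_inj -> //] := ltngtP i k; first exact: hw.
  by apply/esym/hw.
have ik : k != i by rewrite -val_eqE /= gtn_eqF.
rewrite (flux_split _ bS iS kS) // (flux_split _ bS kS iS) 1?eq_sym //.
have -> : S :\ k :\ i = S :\ i :\ k.
  by apply/setP => j; rewrite !inE andbCA.
rewrite setUC; apply: eq_bigr => t /andP[St /eqP zt]; congr (_ * _).
have rt : realizable t := realizable_up (realizable_vtx S) St.
rewrite setUC in zt; have := gamma_bdryE fc rt lt zt; rewrite dc ffunE.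
by move/esym/eqP; rewrite subr_eq0 => /eqP->.
Qed.
(** * The comparison map *)

Lemma region_chainE F s : region R B psi F -> region_chain R B psi F s =
  if [&& preceq s F, #|zeros s| == 1%N & `[< realizable s >]]
  then \prod_(j in zeros s) sign_val (F j) else 0.
Proof.
move=> /regionE[rF _ fF]; rewrite ffunE (cell_dim_realizable rF).
have zF : #|zeros F| = 0%N.
  by apply: eq_card0 => i; rewrite zerosE (negPf (fF i)).
rewrite zF subn0; have [rs|nrs] := asboolP (realizable s); last first.
  by rewrite !andbF; case: asboolP => // /(faceE _ rF)[].
rewrite andbT orient_coefE; last exact: indep_zeros.
rewrite cell_dim_realizable // eqSS.
have -> : (m == m.+1 - #|zeros s|)%N = (#|zeros s| == 1%N).
  by rewrite -(eqn_add2r #|zeros s|) subnK ?zeros_card // -[m.+1]addn1 eqn_add2l.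
by congr (if _ && _ then _ else _); apply/asboolP/idP => [/(faceE _ rF)[]|sF];
  [|apply/(faceE _ rF)].
Qed.

Lemma region_facets F : region R B psi F -> facets (region_chain R B psi F).
Proof.
move=> RF s; rewrite region_chainE //; case: ifPn; last by rewrite eqxx.
case/and3P=> sF /eqP z1 /asboolP rs _; split=> //.
by case/regionE: RF => rF bF _; apply: cell_bounded_face sF rF bF.
Qed.

Lemma flux_region F S i : region R B psi F -> basis_set S -> i \in S ->
  flux (region_chain R B psi F) S i =
  if preceq (vtx S) F then \prod_(j in S) sign_val (F j) else 0.
Proof.
move=> RF bS iS; have [rF _ fF] := (regionE F).1 RF.
have wall s : preceq (vtx S) s -> zeros s = [set i] ->
    region_chain R B psi F s = if preceq s F then sign_val (F i) else 0.
  move=> Ss zs; have rs := realizable_up (realizable_vtx S) Ss.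
  rewrite region_chainE // zs cards1 big_set1 eqxx /=.
  by case: asboolP; rewrite ?andbT.
rewrite /flux; case: ifPn => [SF|nSF]; last first.
  apply: big1 => s /andP[Ss /eqP zs]; rewrite wall //.
  by case: ifP => [sF|]; [rewrite (preceq_trans Ss sF) in nSF|rewrite mulr0].
have zF : zeros F :|: [set i] = [set i].
  by apply/setP => j; rewrite !inE (negPf (fF j)).
rewrite (bigD1 (mask F [set i])) /=; last first.
  by rewrite preceq_mask ?sub1set ?zeros_vtx // zeros_mask zF /=.
rewrite [X in _ + X]big1 ?addr0 => [|s /andP[/andP[Ss /eqP zs] sF]]; last first.
  rewrite wall //; case: ifP => [sF'|]; last by rewrite mulr0.
  by rewrite (mask_eq sF') ?eqxx // in sF; rewrite zF zs.
rewrite wall ?mask_preceq ?zeros_mask ?zF //; last first.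
  by rewrite preceq_mask ?sub1set ?zeros_vtx.
rewrite [RHS](big_setD1 i) //= mulrC; congr (_ * _); apply: eq_bigr => j.
by rewrite !inE => /andP[/negPf ji _]; rewrite maskE inE ji.
Qed.

(** In dimension one the cells of [Gamma] are points, and the augmentation is
    the condition at the empty set of the corresponding chain of the nerve. *)
Lemma gamma_augE (c : chain Gam) : m = 0%N -> facets c ->
  \sum_s c s * aug (b := Gam) s =
  \sum_(i | (i \notin set0) && basis_set (i |: set0))
     flux c (i |: set0) i * sgz (dot (b i) (tau set0)).
Proof.
move=> m0 fc; under [RHS]eq_bigr do rewrite /flux mulr_suml.
rewrite (exchange_big_dep xpredT) //=; apply: eq_bigr => s _.
have [->|/fc[rs bs z1]] := eqVneq (c s) 0.
  by rewrite mul0r big1 // => i _; rewrite mulr0 mul0r.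
have [|bz sE] := vtx_zeros rs; first by rewrite z1 m0.
move/eqP: (z1) => /cards1P[i zi].
rewrite /= orient_refE ?zeros_card //. rewrite orient0_vertex zi; rewrite zi in bz sE.
rewrite (bigD1 i) /=; last by rewrite inE setU0 bz -sE preceq_refl eqxx.
rewrite [X in _ + X]big1 ?addr0 => [|k /andP[/andP[_ /andP[_ /eqP zk]] ki]]; last first.
  by move: ki; rewrite (set1_inj zk) eqxx.
rewrite setU0 setDv big1 ?mul1r => [|j]; last by rewrite inE.
congr (_ * _); rewrite (basis_det_tau R B (basis_card bz) (set11 i)) setDv.
rewrite (_ : [set j in _ | _] = set0) ?cards0 ?mul1r //.
by apply/setP => j; rewrite !inE; case: eqP => // ->; rewrite ltnn.
Qed.

Lemma gamma_cyclesP (c : chain Gam) :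
  reflect [/\ facets c, bdry c = 0 & m = 0%N ->
    \sum_(i | (i \notin set0) && basis_set (i |: set0))
      flux c (i |: set0) i * sgz (dot (b i) (tau set0)) = 0]
  (c \in cycles Gam m).
Proof.
apply: (iffP and3P) => [[/gamma_kchainsP fc /eqP dc /implyP ac]|[fc dc ac]].
  by split=> // m0; rewrite -gamma_augE //; apply/eqP/ac; rewrite m0.
split; [exact/gamma_kchainsP | exact/eqP |].
by apply/implyP => /eqP m0; rewrite gamma_augE // ac.
Qed.

(** A face of codimension two of [F] lies in exactly two facets, where the
    inward normals give opposite contributions; in dimension one [F] is a segment
    with two ends. *)
Lemma region_cycle F : region R B psi F -> region_chain R B psi F \in cycles Gam m.
Proof.
move=> RF; have fF := region_facets RF; have [rF bF full] := (regionE F).1 RF.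
have zF j : zeros F :|: [set j] = [set j].
  by apply/setP => k; rewrite !inE (negPf (full k)).
apply/gamma_cyclesP; split=> //.
- apply/ffunP => t; rewrite [RHS]ffunE.
  have [[rt z2]|] := EM (realizable t /\ #|zeros t| = 2%N); last exact: gamma_bdry0.
  have [i [k [lt zt]]] : exists i k : 'I_n, (i < k)%N /\ zeros t = [set i; k].
    move/eqP: z2 => /cards2P[i [k [+ zt]]]; rewrite -val_eqE neq_ltn /= => ik.
    by case/orP: ik => lt; [exists i, k | exists k, i; rewrite setUC].
  have side i' k' : zeros t = [set i'; k'] -> k' != i' ->
    \sum_(s | preceq t s && (zeros s == [set i'])) sign_val (s k') * region_chain R B psi F s
    = if preceq t F then sign_val (F k') * sign_val (F i') else 0.
    move=> zt' ki.
    have wall s : preceq t s -> zeros s = [set i'] ->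
        region_chain R B psi F s = if preceq s F then sign_val (F i') else 0.
      move=> ts zs; have rs := realizable_up rt ts.
      rewrite region_chainE // zs cards1 big_set1 eqxx /=.
      by case: asboolP; rewrite ?andbT.
    case: ifPn => [tF|ntF]; last first.
      apply: big1 => s /andP[ts /eqP zs]; rewrite wall //.
      by case: ifP => [sF|]; [rewrite (preceq_trans ts sF) in ntF|rewrite mulr0].
    have tm : preceq t (mask F [set i']).
      by apply: preceq_mask; rewrite // zt' sub1set setU11.
    rewrite (bigD1 (mask F [set i'])) /=; last by rewrite tm zeros_mask zF /=.
    rewrite big1 ?addr0 => [|s /andP[/andP[ts /eqP zs] sF]]; last first.
      rewrite wall //; case: ifP => [sF'|]; last by rewrite mulr0.
      by rewrite (mask_eq sF') ?eqxx // in sF; rewrite zF zs.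
    by rewrite wall ?mask_preceq ?zeros_mask ?zF // maskE inE (negPf ki).
  have ik : k != i by rewrite -val_eqE /= gtn_eqF.
  rewrite (gamma_bdryE fF rt lt zt) side ?side // 1?setUC // 1?eq_sym //.
  by rewrite mulrC subrr.
- move=> m0; rewrite -[RHS](edge_sum rF bF (T := set0)) ?cards0 //; last first.
    by apply/subsetP => j; rewrite zerosE (negPf (full j)).
  rewrite big_mkcond [RHS]big_mkcond /=; apply: eq_bigr => i _.
  rewrite inE /=; case: (boolP (basis_set _)) => //= bi.
  rewrite flux_region ?setU11 //; case: ifP; rewrite ?mul0r // setU0.
  by rewrite big_set1.
Qed.

(** Any element of [S] may be picked when [c] is a cycle, by [flux_indep]. *)
Definition Phi (c : chain Gam) : chain Nerve :=
  [ffun S : {set 'I_n} => if basis_set S then sgz (basis_det R B S) *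
     (if [pick i in S] is Some i then flux c S i else 0) else 0].

Lemma PhiB c e : Phi (c - e) = Phi c - Phi e.
Proof.
have fluxB S i : flux (c - e) S i = flux c S i - flux e S i.
  by rewrite -sumrB; apply: eq_bigr => s _; rewrite !ffunE mulrBr.
apply/ffunP => S; rewrite !ffunE; case: ifP => _; last by rewrite subr0.
by case: pickP => [i _|_]; rewrite ?fluxB ?mulrBr // !mulr0 subr0.
Qed.

Lemma PhiE (c : chain Gam) S i : facets c -> bdry c = 0 -> basis_set S -> i \in S ->
  Phi c S = sgz (basis_det R B S) * flux c S i.
Proof.
move=> fc dc bS iS; rewrite ffunE bS; congr (_ * _).
by case: pickP => [k kS|/(_ i)]; [exact: flux_indep | rewrite iS].
Qed.

Lemma det_coef_Phi (c : chain Gam) S i : facets c -> bdry c = 0 -> basis_set S ->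
  i \in S -> det_coef (Phi c) S = flux c S i.
Proof.
move=> fc dc bS iS; rewrite /det_coef (PhiE fc dc bS iS) mulrA sgz_sqr ?mul1r //.
exact: basis_det_neq0.
Qed.

Lemma Phi_region F : region R B psi F ->
  Phi (region_chain R B psi F) = Psi_chain R B psi F.
Proof.
move=> RF; have [rF _ _] := (regionE F).1 RF.
have /gamma_cyclesP[fF dF _] := region_cycle RF.
apply/ffunP => S; rewrite Psi_chainE //.
have [bS|nS] := boolP (basis_set S); last by rewrite ffunE (negPf nS).
have [i iS] : exists i, i \in S.
  by apply/set0Pn; rewrite -card_gt0 (basis_card bS).
rewrite (PhiE fF dF bS iS) flux_region //=; case: ifP => //; by rewrite mulr0.
Qed.

(** At all the vertices of the line of [T] the flux can be taken along one and
    the same hyperplane of [T]. Each cell then contributes the sum over the two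
    ends of its edge on that line; if [T] is empty this is the augmentation. *)
Lemma Phi_cycle (c : chain Gam) : c \in cycles Gam m -> Phi c \in cycles Nerve m.
Proof.
move=> /gamma_cyclesP[fc dc ac]; apply/nerve_cyclesP; split=> [S|T cT].
  by rewrite ffunE; case: ifP; rewrite ?eqxx.
have [T0|[k kT]] := set_0Vmem T.
  rewrite T0 -[RHS]ac; last by rewrite -cT T0 cards0.
  by apply: eq_bigr => i /andP[_ bi]; rewrite (det_coef_Phi fc dc bi (setU11 _ _)).
under eq_bigr => i /andP[iT bi].
  rewrite (det_coef_Phi fc dc bi (setU1r i kT)) /flux mulr_suml; over.
rewrite (exchange_big_dep xpredT) //= big1 // => s _.
have [->|/fc[rs bs z1]] := eqVneq (c s) 0.
  by rewrite big1 // => i _; rewrite mulr0 mul0r.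
have [zs|zs] := eqVneq (zeros s) [set k]; last first.
  by rewrite big_pred0 // => i; rewrite !andbF.
transitivity ((\prod_(j in T :\ k) sign_val (s j)) * c s *
  \sum_(i | [&& i \notin T, basis_set (i |: T) & preceq (vtx (i |: T)) s])
     sign_val (s i) * sgz (dot (b i) (tau T))); last first.
  by rewrite edge_sum ?mulr0 // zs sub1set.
rewrite mulr_sumr; apply: eq_big => [i|i /andP[/andP[iT _] _]]; first by rewrite andbT andbA.
have ik : i != k by apply: contraNneq iT => ->.
rewrite (big_setD1 i) /=; last by rewrite !inE eqxx ik.
have -> : (i |: T) :\ k :\ i = T :\ k.
  by apply/setP => j; rewrite !inE; case: eqP => // ->; rewrite (negPf iT) andbF.
by rewrite -!mulrA mulrCA; congr (_ * _); rewrite mulrCA.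
Qed.

(** At the lowest vertex [S] of the support, each cell of the support lies on the
    increasing side of all edge directions, so only one of those in a given
    hyperplane contains [S] and nothing can cancel it in the flux. *)
Lemma Phi_inj (c : chain Gam) : c \in cycles Gam m -> Phi c = 0 -> c = 0.
Proof.
move=> /gamma_cyclesP[fc dc _] P0; apply/ffunP => s0; rewrite [RHS]ffunE.
apply/eqP; apply: contraT => cs0.
have [l gl _] := @generic_exists [::] (fun _ => ltac:(by [])).
have [rs0 bs0 _] := fc _ cs0; have [S0 bS0 S0s0] := bounded_has_vertex rs0 bs0.
pose P (q : covector n * {set 'I_n}) :=
  [&& c q.1 != 0, basis_set q.2 & preceq (vtx q.2) q.1].
have Pq0 : P (s0, S0) by rewrite /P /= cs0 bS0.
case: (arg_minP (fun q => dot l (vpt q.2)) Pq0) => -[s S] /and3P[/= cs bS Ss] minP.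
have [rs bs /eqP/cards1P[i zi]] := fc _ cs.
have iS : i \in S by rewrite -(zeros_vtx bS) (subsetP (preceq_zeros Ss)) // zi inE.
have low s' j : c s' != 0 -> preceq (vtx S) s' -> j \in S -> s' j != None ->
    esign S l j = sign_val (s' j).
  move=> cs' Ss' jS sj; have [rs' bs' _] := fc _ cs'.
  apply: min_vertex_sign => // [S' bS' S's'|]; last exact: gl.
  by apply: (minP (s', S')); rewrite /P /= cs' bS'.
have : flux c S i = 0.
  have := PhiE fc dc bS iS; rewrite P0 ffunE => /esym/eqP.
  by rewrite mulf_eq0 sgz_eq0 (negPf (basis_det_neq0 bS)) => /eqP.
rewrite /flux (bigD1 s) /=; last by rewrite Ss zi eqxx.
rewrite [X in _ + X]big1 ?addr0 => [|s' /andP[/andP[Ss' /eqP zs'] s's]]; last first.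
  have [->|cs'] := eqVneq (c s') 0; first by rewrite mulr0.
  case/eqP: s's; apply/ffunP => j.
  have [jS|jS] := boolP (j \in S); last first.
    by rewrite (preceq_notin Ss) ?(preceq_notin Ss') // zeros_vtx.
  have [ji|ji] := eqVneq j i.
    have : j \in zeros s' by rewrite zs' ji inE.
    have : j \in zeros s by rewrite zi ji inE.
    by rewrite !zerosE => /eqP-> /eqP->.
  apply: sign_val_inj; rewrite -low // -?low // -zerosE ?zi ?zs' inE //.
move/eqP; rewrite mulf_eq0 (negPf cs) orbF prodf_seq_eq0 => /hasP[j _ /andP[]].
rewrite !inE => /andP[ji jS] sj0; exfalso.
have : j \notin zeros s by rewrite zi inE.
by rewrite zerosE; case: (s j) sj0 => [[]|].
Qed.
HB.instance Definition _ :=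
  GRing.isZmodMorphism.Build (chain Gam) (chain Nerve) Phi PhiB.

Lemma gamma_top (e : chain Gam) : e \in kchains m.+1 -> e = 0.
Proof.
move=> /forallP eP; apply/ffunP => s; rewrite [RHS]ffunE; apply/eqP.
apply: contraT => es; have /implyP/(_ es)/asboolP[bs nr dm] := eP s.
by case: nr.
Qed.

Lemma nerve_top (g : chain Nerve) : g \in kchains m.+1 -> g = 0.
Proof.
move=> /forallP gP; apply/ffunP => S; rewrite [RHS]ffunE; apply/eqP.
apply: contraT => gS; have /implyP/(_ gS)/andP[/asboolP nS /eqP cS] := gP S.
by have := nerve_simplex_card nS; rewrite cS ltnn.
Qed.

(** A cycle of [Gamma] is determined by its image, and the cycles of regions
    map onto generators: so they generate. *)
Lemma region_span (g : chain Nerve) : g \in cycles Nerve m ->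
  exists2 f : covector n -> int, forall F, f F != 0 -> region R B psi F &
    let c := \sum_F region_chain R B psi F *~ f F in
    c \in cycles Gam m /\ Phi c = g.
Proof.
move=> /nerve_cycles_span[f fR gE]; exists f => //=; split.
  apply: rpred_sum => F _; have [->|/fR RF] := eqVneq (f F) 0.
    by rewrite mulr0z rpred0.
  by apply/rpredMz/region_cycle.
rewrite raddf_sum; apply/ffunP => S; rewrite gE sum_ffunE; apply: eq_bigr => F _.
rewrite raddfMz /=; have [->|/fR RF] := eqVneq (f F) 0.
  by rewrite mulr0z mul0r ffunE.
by rewrite Phi_region // ffunMzE mulrzz mulrC.
Qed.

(** Classes being cycles in the top degree, the map on homology is [Phi]. *)
Theorem top_homology_iso :
  [/\ forall F, region R B psi F -> region_chain R B psi F \in cycles Gam m,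
      forall F, region R B psi F -> Psi_chain R B psi F \in cycles Nerve m
    & exists Psi : {additive homology Gam m -> homology Nerve m},
        [/\ forall F, region R B psi F ->
              Psi (hclass m (region_chain R B psi F)) =
              hclass m (Psi_chain R B psi F),
            forall Psi' : {additive homology Gam m -> homology Nerve m},
              (forall F, region R B psi F ->
                 Psi' (hclass m (region_chain R B psi F)) =
                 hclass m (Psi_chain R B psi F)) ->
              Psi' =1 Psi
          & bijective Psi]].
Proof.
have Psi_cycle F : region R B psi F -> Psi_chain R B psi F \in cycles Nerve m.
  by move=> RF; rewrite -Phi_region // Phi_cycle // region_cycle.
split=> //; first exact: region_cycle.
pose f (u : homology Gam m) : homology Nerve m := hclass m (Phi (hrepr u)).
have fE u : hrepr (f u) = Phi (hrepr u).
  by rewrite (hclassK nerve_top) // Phi_cycle // hrepr_cycle.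
have fB : {morph f : u v / u - v}.
  move=> u v; apply: (can_inj (@hreprK Nerve m)).
  by rewrite fE (hreprB gamma_top) PhiB (hreprB nerve_top) !fE.
pose Psi : {additive homology Gam m -> homology Nerve m} :=
  HB.pack f (GRing.isZmodMorphism.Build (homology Gam m) (homology Nerve m) f fB).
pose hr : {additive homology Gam m -> chain Gam} :=
  HB.pack (@hrepr Gam m) (GRing.isZmodMorphism.Build (homology Gam m) (chain Gam)
    (@hrepr Gam m) (hreprB gamma_top)).
have PsiF F : region R B psi F ->
    Psi (hclass m (region_chain R B psi F)) = hclass m (Psi_chain R B psi F).
  by move=> RF; rewrite /= /f (hclassK gamma_top) ?region_cycle // Phi_region.
have Phi_cancel c e : c \in cycles Gam m -> e \in cycles Gam m -> Phi c = Phi e -> c = e.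
  move=> cc ce Pce; apply/eqP; rewrite -subr_eq0; apply/eqP/Phi_inj; first exact: rpredB.
  by rewrite PhiB Pce subrr.
exists Psi; split=> // [Psi' Psi'F u|].
  have [a aR [ca aE]] := region_span (Phi_cycle (hrepr_cycle u)).
  have -> : u = \sum_F hclass m (region_chain R B psi F) *~ a F.
    apply: (can_inj (@hreprK Gam m)); rewrite -[RHS]/(hr _) raddf_sum.
    rewrite (Phi_cancel _ _ (hrepr_cycle u) ca (esym aE)); apply: eq_bigr => F _.
    rewrite raddfMz /=; have [->|/aR RF] := eqVneq (a F) 0; first by rewrite !mulr0z.
    by rewrite (hclassK gamma_top) // region_cycle.
  rewrite !raddf_sum; apply: eq_bigr => F _; rewrite !raddfMz.
  have [->|/aR RF] := eqVneq (a F) 0; first by rewrite !mulr0z.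
  by rewrite Psi'F // PsiF.
have inj_f : injective f.
  move=> u v fuv; apply: (can_inj (@hreprK Gam m)).
  apply: Phi_cancel; rewrite ?hrepr_cycle //.
  by rewrite -!fE fuv.
have /choice[g gK] : forall w, exists u, f u = w.
  move=> w; have [a aR [ca aE]] := region_span (hrepr_cycle w).
  exists (hclass m (\sum_F region_chain R B psi F *~ a F)).
  by rewrite /f (hclassK gamma_top) // aE hreprK.
by exists g => // u; apply: inj_f; rewrite gK.
Qed.

End Cells.

(** * Generic degrees give simple arrangements *)

(** Gale duality. The [b i] with [i] in [S] are dependent if and only if the
    columns [a j] with [j] outside [S] do not span. If moreover [x] lies on the
    hyperplanes of [S], then [B x + psi] expresses the degree through those
    columns, hence through fewer than [d] of them. *)
Lemma generic_simple (R : realType) (d n p : nat) (A : 'M[int]_(d, n))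
    (theta : 'cV[int]_d) (B : 'M[int]_(n, p)) (psi : 'cV[int]_n) :
  generic_degree R A theta -> short_exact A B -> A *m psi = theta ->
  forall (x : 'rV[R]_p) (c : 'I_n -> R),
    \sum_(i | affine_form B psi i x == 0) c i *: normal R B i = 0 ->
    forall i, affine_form B psi i x == 0 -> c i = 0.
Proof.
move=> [_ gen] [_ ker surj] Apsi x c c0 i0 xi0; apply/eqP; apply: contraT => ci0.
pose phi k l (M : 'M[int]_(k, l)) : 'M[R]_(k, l) := map_mx intr M.
have AB : A *m B = 0.
  apply/matrixP => k j; have /ker/matrixP/(_ k 0) : exists z, col j B = B *m z.
    by exists (delta_mx j 0); rewrite colE.
  by rewrite colE mulmxA -colE !mxE.
have /choice[y Ay] : forall k : 'I_d, exists y, A *m y = col k 1%:M by move=> k; apply: surj.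
pose Y : 'M[int]_(n, d) := \matrix_(i, k) y k i 0.
have AY : A *m Y = 1%:M.
  apply/matrixP => i k; move/matrixP: (Ay k) => /(_ i 0); rewrite !mxE => <-.
  by apply: eq_bigr => j _; rewrite mxE.
have /choice[z Bz] : forall j : 'I_n, exists z, col j (1%:M - Y *m A) = B *m z.
  by move=> j; apply/ker; rewrite colE mulmxA mulmxBr mulmxA AY mul1mx mulmx1 subrr mul0mx.
pose C : 'M[int]_(p, n) := \matrix_(k, j) z j k 0.
have BC : B *m C = 1%:M - Y *m A.
  apply/matrixP => i j; move/matrixP: (Bz j) => /(_ i 0); rewrite [LHS]mxE => ->.
  by rewrite !mxE; apply: eq_bigr => k _; rewrite mxE.
pose S := [set i | affine_form B psi i x == 0].
pose v : 'rV[R]_n := \row_i (if i \in S then c i else 0).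
have vB : v *m phi _ _ B = 0.
  rewrite -[RHS]c0 mulmx_sum_row [RHS]big_mkcond; apply: eq_bigr => i _.
  by rewrite mxE inE; case: ifP => // _; rewrite scale0r.
pose u := v *m phi _ _ Y.
have uA : u *m phi _ _ A = v.
  have : v *m phi _ _ (B *m C) = 0 by rewrite /phi map_mxM mulmxA vB mul0mx.
  rewrite BC /phi map_mxB map_mx1 map_mxM mulmxBr mulmx1 mulmxA => /eqP.
  by rewrite subr_eq0 => /eqP <-.
have u0 : u != 0.
  apply: contraNneq ci0 => u0; move: uA; rewrite u0 mul0mx => /rowP/(_ i0).
  by rewrite !mxE inE xi0 => <-.
pose M : 'M[R]_(n, d) := \matrix_(j < n) (if j \in S then 0 else (col j (phi _ _ A))^T).
have Mu : M *m u^T = 0.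
  apply/row_matrixP => j; rewrite row_mul rowK row0; case: ifP => jS; first by rewrite mul0mx.
  rewrite -trmx_mul colE mulmxA uA -colE; apply/matrixP => k l.
  by rewrite !mxE jS.
have rM : (\rank M < d)%N.
  rewrite ltn_neqAle rank_leq_col andbT; apply: contra u0 => fM.
  have /row_fullP[M' M'M] : row_full M by [].
  by rewrite -trmx_eq0 -[u^T]mul1mx -M'M -mulmxA Mu mulmx0.
pose w : 'rV[R]_n := \row_j affine_form B psi j x.
have wM : w *m M = (phi _ _ theta)^T.
  have -> : w *m M = w *m (phi _ _ A)^T.
    rewrite !mulmx_sum_row; apply: eq_bigr => j _; rewrite !mxE rowK tr_col.
    by case: ifP => //; rewrite inE => /eqP->; rewrite !scale0r.
  have -> : w = x *m (phi _ _ B)^T + (phi _ _ psi)^T.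
    apply/rowP => j; rewrite !mxE; congr (_ + _).
    by apply: eq_bigr => k _; rewrite !mxE mulrC.
  rewrite mulmxDl -mulmxA -!trmx_mul /phi -!map_mxM AB Apsi.
  by rewrite map_mx0 trmx0 mulmx0 add0r.
pose f := maxrankfun M.
have /submxP[q qE] : ((phi _ _ theta)^T <= rowsub f M)%MS.
  by rewrite eq_maxrowsub -wM submxMl.
case: (gen [set f k | k : 'I_(\rank M)]).
  by rewrite card_imset ?card_ord //; apply: maxrankfun_inj.
exists (fun i => if i \in S then 0 else \sum_(k | f k == i) q 0 k).
rewrite big_imset /=; last by move=> ? ? _ _; apply: maxrankfun_inj.
apply: (can_inj trmxK); rewrite -/(phi _ _ theta) qE mulmx_sum_row raddf_sum /=.
apply: eq_big => // k _; rewrite (big_pred1 k) => [|k']; last first.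
  by rewrite (inj_eq (@maxrankfun_inj _ _ _ M)).
by rewrite row_rowsub rowK linearZ /= map_col; case: ifP; rewrite ?scaler0 ?scale0r.
Qed.

Theorem proposition4 (R : realType) (d n : nat) (A : 'M[int]_(d, n))
    (theta : 'cV[int]_d) (B : 'M[int]_(n, n - d)) (psi : 'cV[int]_n) :
  (d < n)%N ->
  minors_coprime A ->
  smooth_degree R A theta ->
  short_exact A B ->
  A *m psi = theta ->
  [/\ forall F : covector n, region R B psi F ->
        region_chain R B psi F \in cycles (Gamma_complex R B psi) (n - d - 1),
      forall F : covector n, region R B psi F ->
        Psi_chain R B psi F \in cycles (nerve_complex R B psi) (n - d - 1)
    & exists Psi : {additive homology (Gamma_complex R B psi) (n - d - 1) ->
                             homology (nerve_complex R B psi) (n - d - 1)},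
        [/\ forall F : covector n, region R B psi F ->
              Psi (hclass (n - d - 1) (region_chain R B psi F)) =
              hclass (n - d - 1) (Psi_chain R B psi F),
            forall Psi' : {additive homology (Gamma_complex R B psi) (n - d - 1) ->
                                    homology (nerve_complex R B psi) (n - d - 1)},
              (forall F : covector n, region R B psi F ->
                 Psi' (hclass (n - d - 1) (region_chain R B psi F)) =
                 hclass (n - d - 1) (Psi_chain R B psi F)) ->
              Psi' =1 Psi
          & bijective Psi]].
Proof.
move=> dn _ [gen _] exactAB Apsi; have := generic_simple gen exactAB Apsi.
have : (n - d = (n - d - 1).+1)%N by rewrite subn1 prednK // subn_gt0.
move: (n - d - 1)%N => m; move: (n - d)%N B {exactAB} => p B pE; subst p => simple.
apply: top_homology_iso => x c c0 i; rewrite zerosE cov_None => xi.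
apply: simple xi; rewrite -[RHS]c0; apply: eq_bigl => j.
by rewrite zerosE cov_None.
Qed.
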